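(* Suppose $\Gamma_1$ and $\Gamma_2$ are nontrivial countable groups and that for each $i\in\{1,2\}$, $\Gamma_i$ is either finite or has property $\mathrm{MD}$. Then the free product $\Gamma_1*\Gamma_2$ has property $\mathrm{EMD}$.
   Context: A measure preserving action $\bm{a}=\Gamma\curvearrowright^a(X,\mu)$ of a countable group $\Gamma$ is a Borel action $a$ of $\Gamma$ on a standard Borel space $X$ preserving a Borel probability measure $\mu$ on $X$. Weak containment: for $\bm{a}$ on $(X,\mu)$ and $\bm{b}$ on $(Y,\nu)$, $\bm{a}\prec\bm{b}$ means that for every finite measurable partition $A_0,\dots,A_{k-1}$ of $X$, every finite $F\subseteq\Gamma$, and every $\epsilon>0$ there is a measurable partition $B_0,\dots,B_{k-1}$ of $Y$ with $|\mu(\gamma^aA_i\cap A_j)-\nu(\gamma^bB_i\cap B_j)|<\epsilon$ for all $\gamma\in F$ and $i,j<k$. Let $\bm{p}_\Gamma$ denote the action of $\Gamma$ by left translation (via the canonical homomorphism) on its profinite completion, equipped with normalized Haar measure (if the profinite completion is not metrizable, the definition of weak containment is applied verbatim to this probability space). Let $\bm{\iota}$ denote the identity action of $\Gamma$ on a standard non-atomic probability space, and $\bm{\iota}\times\bm{p}_\Gamma$ the product action with product measure. A countably infinite group $\Gamma$ has property $\mathrm{EMD}$ if $\bm{b}\prec\bm{p}_\Gamma$ for every measure preserving action $\bm{b}$ of $\Gamma$; it has property $\mathrm{MD}$ if $\bm{b}\prec\bm{\iota}\times\bm{p}_\Gamma$ for every measure preserving action $\bm{b}$ of $\Gamma$.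 *)

(* Defs.v *)
From HB Require Import structures.
From mathcomp Require Import all_boot all_order all_algebra generic_quotient.
From mathcomp Require Import all_classical all_reals all_analysis.

Set Implicit Arguments.
Unset Strict Implicit.
Unset Printing Implicit Defensive.

Import Order.TTheory GRing.Theory Num.Theory.
Import numFieldNormedType.Exports.

Local Open Scope classical_set_scope.
Local Open Scope ring_scope.
Local Open Scope quotient_scope.

(** The free product is the quotient of the monoid of words in the disjoint
    union of the two groups by the congruence generated by [x . y = xy] (for
    letters x, y from the same factor) and [1 = empty word]; see [free_product_universal]. *)

Section FreeProduct.
Variables G1 G2 : groupType.
Local Open Scope group_scope.

Definition fp_word : choiceType := seq (G1 + G2)%type.

Inductive fp_eq : fp_word -> fp_word -> Prop :=
| fp_refl u : fp_eq u u
| fp_sym u v : fp_eq u v -> fp_eq v u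
| fp_trans v u w : fp_eq u v -> fp_eq v w -> fp_eq u w
| fp_one1 u v : fp_eq (u ++ inl 1 :: v) (u ++ v)
| fp_one2 u v : fp_eq (u ++ inr 1 :: v) (u ++ v)
| fp_mul1 u v x y :
    fp_eq (u ++ inl x :: inl y :: v) (u ++ inl (x * y) :: v)
| fp_mul2 u v x y :
    fp_eq (u ++ inr x :: inr y :: v) (u ++ inr (x * y) :: v).

Definition fp_rel : rel fp_word := fun u v => `[< fp_eq u v >].

Lemma fp_rel_equiv : equiv_class_of fp_rel.
Proof.
split=> [u|u v|v u w]; first exact/asboolP/fp_refl.
- by apply/asboolP/asboolP; exact: fp_sym.
- by move=> /asboolP uv /asboolP vw; apply/asboolP; apply: fp_trans uv vw.
Qed.

Canonical fp_equiv : equiv_rel fp_word := EquivRelPack fp_rel_equiv.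

Definition free_product := {eq_quot fp_equiv}.

HB.instance Definition _ := Choice.on free_product.
HB.instance Definition _ := EqQuotient.on free_product.

Definition fp_pi (u : fp_word) : free_product := \pi_free_product u.

Lemma fp_piP u v : fp_pi u = fp_pi v <-> fp_eq u v.
Proof.
split=> [/eqmodP/asboolP //|uv]; apply/eqmodP; exact/asboolP.
Qed.

Lemma fp_reprK (a : free_product) : fp_pi (repr a) = a.
Proof. exact: reprK. Qed.

Lemma fp_eq_catl w u v : fp_eq u v -> fp_eq (w ++ u) (w ++ v).
Proof.
elim=> {u v} [u|u v _|v u t _ + _|u v|u v|u v x y|u v x y].
- exact: fp_refl.
- exact: fp_sym.
- exact: fp_trans.
- by rewrite !catA; exact: fp_one1.
- by rewrite !catA; exact: fp_one2.
- by rewrite !catA; exact: fp_mul1.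
- by rewrite !catA; exact: fp_mul2.
Qed.

Lemma fp_eq_catr w u v : fp_eq u v -> fp_eq (u ++ w) (v ++ w).
Proof.
elim=> {u v} [u|u v _|v u t _ + _|u v|u v|u v x y|u v x y].
- exact: fp_refl.
- exact: fp_sym.
- exact: fp_trans.
- by rewrite -!catA; exact: fp_one1.
- by rewrite -!catA; exact: fp_one2.
- by rewrite -!catA; exact: fp_mul1.
- by rewrite -!catA; exact: fp_mul2.
Qed.

Definition fp_letterV (l : G1 + G2) : G1 + G2 :=
  match l with inl x => inl x^-1 | inr y => inr y^-1 end.

Definition fp_wordV (u : fp_word) : fp_word := rev (map fp_letterV u).

Definition fp_one : free_product := fp_pi [::].
Definition fp_mul (a b : free_product) : free_product :=
  fp_pi (repr a ++ repr b).
Definition fp_inv (a : free_product) : free_product := fp_pi (fp_wordV (repr a)).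

Lemma fp_mulE u v : fp_mul (fp_pi u) (fp_pi v) = fp_pi (u ++ v).
Proof.
apply/fp_piP; apply: (@fp_trans (u ++ repr (fp_pi v))).
  by apply/fp_eq_catr/fp_piP; exact: fp_reprK.
by apply/fp_eq_catl/fp_piP; exact: fp_reprK.
Qed.

Lemma fp_wordVr u : fp_eq (u ++ fp_wordV u) [::].
Proof.
elim: u => [|l u IH]; first exact: fp_refl.
rewrite /fp_wordV /= rev_cons -cats1 catA.
apply: (@fp_trans [:: l; fp_letterV l]).
  apply: (@fp_eq_catl [:: l] _ [:: fp_letterV l]).
  exact: (@fp_eq_catr [:: fp_letterV l] _ [::]).
case: l => x /=.
- apply: fp_trans (fp_mul1 [::] [::] x x^-1) _; rewrite mulgV.
  exact: (fp_one1 [::] [::]).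
- apply: fp_trans (fp_mul2 [::] [::] x x^-1) _; rewrite mulgV.
  exact: (fp_one2 [::] [::]).
Qed.

Lemma fp_wordVK : involutive fp_wordV.
Proof.
move=> u; rewrite /fp_wordV map_rev revK -map_comp -[RHS]map_id.
by apply: eq_map => -[x|y] /=; rewrite invgK.
Qed.

Lemma fp_mulA : associative fp_mul.
Proof.
move=> a b c; rewrite -(fp_reprK a) -(fp_reprK b) -(fp_reprK c).
by rewrite !fp_mulE catA.
Qed.

Lemma fp_mul1g : left_id fp_one fp_mul.
Proof. by move=> a; rewrite -(fp_reprK a) fp_mulE. Qed.

Lemma fp_mulg1 : right_id fp_one fp_mul.
Proof. by move=> a; rewrite -(fp_reprK a) fp_mulE cats0. Qed.

Lemma fp_mulgV : right_inverse fp_one fp_inv fp_mul.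
Proof.
move=> a; rewrite -{1}(fp_reprK a) fp_mulE; apply/fp_piP; exact: fp_wordVr.
Qed.

Lemma fp_mulVg : left_inverse fp_one fp_inv fp_mul.
Proof.
move=> a; rewrite -{2}(fp_reprK a) fp_mulE; apply/fp_piP.
by rewrite -{2}[repr a]fp_wordVK; exact: fp_wordVr.
Qed.

HB.instance Definition _ := isGroup.Build free_product
  fp_mulA fp_mul1g fp_mulg1 fp_mulVg fp_mulgV.

Definition fp_inl (x : G1) : free_product := fp_pi [:: inl x].
Definition fp_inr (y : G2) : free_product := fp_pi [:: inr y].

Lemma fp_inlM : {morph fp_inl : x y / x * y}.
Proof.
move=> x y; rewrite [RHS]fp_mulE; apply/fp_piP/fp_sym.
exact: (fp_mul1 [::] [::]).
Qed.

Lemma fp_inrM : {morph fp_inr : x y / x * y}.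
Proof.
move=> x y; rewrite [RHS]fp_mulE; apply/fp_piP/fp_sym.
exact: (fp_mul2 [::] [::]).
Qed.

Lemma free_product_universal (H : groupType)
    (f1 : {multiplicative G1 -> H}) (f2 : {multiplicative G2 -> H}) :
  exists! f : free_product -> H,
    [/\ {morph f : a b / a * b}, f \o fp_inl = f1 & f \o fp_inr = f2].
Proof.
pose e l := match l with inl x => f1 x | inr y => f2 y end.
pose F (u : fp_word) : H := \prod_(l <- u) e l.
have mor1 (K L : groupType) (f : K -> L) : {morph f : x y / x * y} -> f 1 = 1.
  by move=> fM; apply: (@mulgI _ (f 1)); rewrite -fM !mulg1.
have f11 : f1 1 = 1 by apply: mor1; exact: gmulfM.
have f21 : f2 1 = 1 by apply: mor1; exact: gmulfM.
have FE u v : fp_eq u v -> F u = F v.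
  elim=> // {u v} [v u w _ -> _ -> //|u v|u v|u v x y|u v x y];
    rewrite /F !big_cat !big_cons /=.
  - by rewrite f11 mul1g.
  - by rewrite f21 mul1g.
  - by rewrite gmulfM -!mulgA.
  - by rewrite gmulfM -!mulgA.
have FpiE u : F (repr (fp_pi u)) = F u by apply/FE/fp_piP; exact: fp_reprK.
exists (F \o repr); split; first split=> [a b||] /=.
- rewrite -{1}(fp_reprK a) -{1}(fp_reprK b) [fp_pi _ * _]fp_mulE FpiE.
  by rewrite /F big_cat.
- by apply/funext => x; rewrite /= FpiE /F big_seq1.
- by apply/funext => x; rewrite /= FpiE /F big_seq1.
move=> g [gM g1 g2]; apply/funext => a; rewrite /= -{2}(fp_reprK a).
elim: (repr a) => [|l u IH]; first by rewrite /F big_nil mor1.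
have -> : fp_pi (l :: u) = fp_pi [:: l] * fp_pi u by rewrite [RHS]fp_mulE.
rewrite gM -IH /F big_cons; congr (_ * _).
by case: l => x /=; rewrite -?g1 -?g2.
Qed.

End FreeProduct.

Section ProfiniteCompletion.
Variable G : groupType.
Local Open Scope group_scope.

Definition coset_left (x : G) (N : set G) : set G := [set x * n | n in N].

Record fin_normal := FinNormal {
  fn_set :> set G ;
  fn1 : fn_set 1 ;
  fnM : forall x y, fn_set x -> fn_set y -> fn_set (x * y) ;
  fnV : forall x, fn_set x -> fn_set x^-1 ;
  fnJ : forall x y, fn_set x -> fn_set (x ^ y) ;
  fn_index : finite_set [set coset_left x fn_set | x in [set: G]]
}.

HB.instance Definition _ := gen_eqMixin fin_normal.
HB.instance Definition _ := gen_choiceMixin fin_normal.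

(** The inverse limit of the finite quotients [G / N]: a point is a family
    choosing a coset [x N] of each [N], compatibly with the projections
    [G / N -> G / M] for [N] included in [M] (a coset of [N] is mapped to the
    unique coset of [M] that contains it). *)
Definition profinite_set :
    set (prod_topology (fun _ : fin_normal => discrete_topology (set G))) :=
  [set x | (forall N : fin_normal, exists g, x N = coset_left g N) /\
           (forall N M : fin_normal, N `<=` M -> x N `<=` x M)].

Definition profinite : Type := set_type profinite_set.

HB.instance Definition _ := Topological.copy profinite (set_type profinite_set).

Definition pf_val (x : profinite) : fin_normal -> set G := val x.

Lemma pf_valP (x : profinite) : profinite_set (pf_val x).
Proof. by have := valP x; rewrite inE. Qed.

Lemma pf_inj (x y : profinite) : (forall N, pf_val x N = pf_val y N) -> x = y.
Proof. by move=> xy; apply/val_inj/functional_extensionality_dep. Qed.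

Definition pf_mk (x : fin_normal -> set G) (xP : profinite_set x) : profinite :=
  exist _ x (mem_set xP).

Lemma coset_leftM (N : fin_normal) g h :
  [set a * b | a in coset_left g N & b in coset_left h N] =
  coset_left (g * h) N.
Proof.
apply/seteqP; split=> [_ [_ [n Nn <-]] [_ [m Nm <-]] <-|_ [n Nn <-]].
- exists (n ^ h * m); first by apply: fnM => //; exact: fnJ.
  by rewrite /conjg -!mulgA mulVKg.
- exists g; first by exists 1; [exact: fn1|rewrite mulg1].
  by exists (h * n); [exists n|rewrite mulgA].
Qed.

Lemma coset_leftV (N : fin_normal) g :
  [set a^-1 | a in coset_left g N] = coset_left g^-1 N.
Proof.
apply/seteqP; split=> [_ [_ [n Nn <-]] <-|_ [n Nn <-]].
- exists (n^-1 ^ g^-1); first by apply: fnJ; exact: fnV.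
  by rewrite /conjg invgK invgM mulKg.
- exists (g * (n^-1 ^ g)).
    by exists (n^-1 ^ g) => //; apply: fnJ; exact: fnV.
  by rewrite /conjg mulVKg invgM invgK.
Qed.

Lemma coset_left_eq1 (N : fin_normal) : coset_left 1 N = N.
Proof.
apply/seteqP; split=> [_ [n Nn <-]|n Nn]; first by rewrite mul1g.
by exists n => //; rewrite mul1g.
Qed.

Lemma profinite_eta_subproof (g : G) :
  profinite_set (fun N : fin_normal => coset_left g N).
Proof. by split=> [N|N M NM _ [n Nn <-]]; [exists g|exists n => //; exact: NM]. Qed.

Definition profinite_eta (g : G) : profinite := pf_mk (profinite_eta_subproof g).

Lemma pf_mul_subproof (x y : profinite) : profinite_set
  (fun N : fin_normal => [set a * b | a in pf_val x N & b in pf_val y N]).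
Proof.
have [xN xM] := pf_valP x; have [yN yM] := pf_valP y; split=> [N|N M NM].
- have [g ->] := xN N; have [h ->] := yN N.
  by exists (g * h); exact: coset_leftM.
- move=> _ [a xa [b yb <-]].
  by exists a; [exact: (xM N)|exists b => //; exact: (yM N)].
Qed.

Lemma pf_inv_subproof (x : profinite) : profinite_set
  (fun N : fin_normal => [set a^-1 | a in pf_val x N]).
Proof.
have [xN xM] := pf_valP x; split=> [N|N M NM].
- by have [g ->] := xN N; exists g^-1; exact: coset_leftV.
- by move=> _ [a xa <-]; exists a => //; exact: (xM N).
Qed.

Definition pf_mul (x y : profinite) : profinite := pf_mk (pf_mul_subproof x y).
Definition pf_inv (x : profinite) : profinite := pf_mk (pf_inv_subproof x).

Lemma pf_mulE x y N g h : pf_val x N = coset_left g N ->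
  pf_val y N = coset_left h N -> pf_val (pf_mul x y) N = coset_left (g * h) N.
Proof. by move=> xg yh; rewrite -coset_leftM -xg -yh. Qed.

Lemma pf_invE x N g : pf_val x N = coset_left g N ->
  pf_val (pf_inv x) N = coset_left g^-1 N.
Proof. by move=> xg; rewrite -coset_leftV -xg. Qed.

Lemma pf_coset (x : profinite) N : exists g, pf_val x N = coset_left g N.
Proof. by have [] := pf_valP x. Qed.

Lemma pf_mulA : associative pf_mul.
Proof.
move=> x y z; apply: pf_inj => N.
have [g xg] := pf_coset x N; have [h yh] := pf_coset y N.
have [k zk] := pf_coset z N.
rewrite (pf_mulE xg (pf_mulE yh zk)) (pf_mulE (pf_mulE xg yh) zk).
by rewrite mulgA.
Qed.

Lemma pf_mul1g : left_id (profinite_eta 1) pf_mul.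
Proof.
move=> x; apply: pf_inj => N; have [g xg] := pf_coset x N.
by rewrite (@pf_mulE _ _ _ 1 g _ xg)// mul1g.
Qed.

Lemma pf_mulg1 : right_id (profinite_eta 1) pf_mul.
Proof.
move=> x; apply: pf_inj => N; have [g xg] := pf_coset x N.
by rewrite (@pf_mulE _ _ _ g 1 xg)// mulg1.
Qed.

Lemma pf_mulVg : left_inverse (profinite_eta 1) pf_inv pf_mul.
Proof.
move=> x; apply: pf_inj => N; have [g xg] := pf_coset x N.
by rewrite (pf_mulE (pf_invE xg) xg) mulVg.
Qed.

Lemma pf_mulgV : right_inverse (profinite_eta 1) pf_inv pf_mul.
Proof.
move=> x; apply: pf_inj => N; have [g xg] := pf_coset x N.
by rewrite (pf_mulE xg (pf_invE xg)) mulgV.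
Qed.

HB.instance Definition _ := isPointed.Build profinite (profinite_eta 1).
HB.instance Definition _ := isGroup.Build profinite
  pf_mulA pf_mul1g pf_mulg1 pf_mulVg pf_mulgV.

Lemma profinite_etaM : {morph profinite_eta : x y / x * y}.
Proof.
by move=> x y; apply: pf_inj => N; rewrite (@pf_mulE _ _ _ x y).
Qed.

End ProfiniteCompletion.

Definition borelType (T : ptopologicalType) := g_sigma_algebraType (@open T).

HB.instance Definition _ (T : ptopologicalType) := Measurable.on (borelType T).

(** Radon probability measures on the Borel sets of the profinite completion
    that are invariant under left translations.  Radon-ness is automatic when
    the completion is metrizable; in general it is what makes Haar measure
    unique. *)
Definition is_haar (R : realType) (G : groupType)
    (mu : probability (borelType (profinite G)) R) : Prop :=
  (forall (x : profinite G) (A : set (profinite G)),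
      measurable (A : set (borelType (profinite G))) ->
      mu [set (x * y)%g | y in A] = mu A) /\
  (forall A : set (profinite G),
      measurable (A : set (borelType (profinite G))) ->
      mu A = ereal_sup
        [set mu K | K in [set K : set (profinite G) | compact K /\ K `<=` A]]).

(** The [if and only if] says that the bijection [f] onto a complete separable
    metric space is Borel with Borel inverse. *)
Definition standard_borel (R : realType) d (X : measurableType d) : Prop :=
  exists M : metricType R,
    [/\ (forall F : set_system M, ProperFilter F -> cauchy F ->
           exists x : M, F --> x),
        (exists2 D : set M, countable D & dense D) &
        exists f : X -> M, bijective f /\
          forall B : set M, <<s @open M >> B <-> measurable (f @^-1` B)].

Definition mp_action (G : groupType) (R : realType) d (X : measurableType d)
    (mu : probability X R) (a : G -> X -> X) : Prop :=
  [/\ forall x, a 1%g x = x,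
      forall g h x, a (g * h)%g x = a g (a h x),
      forall g, measurable_fun [set: X] (a g) &
      forall g (A : set X), measurable A -> mu (a g @^-1` A) = mu A].

Definition measurable_partition d (X : measurableType d) (k : nat)
    (A : 'I_k -> set X) : Prop :=
  [/\ forall i, measurable (A i),
      trivIset [set: 'I_k] A &
      \bigcup_(i in [set: 'I_k]) A i = [set: X]].

Definition weakly_contained (G : groupType) (R : realType)
    d (X : measurableType d) (mu : probability X R) (a : G -> X -> X)
    d' (Y : measurableType d') (nu : probability Y R) (b : G -> Y -> Y) :
    Prop :=
  forall (k : nat) (A : 'I_k -> set X), measurable_partition A ->
  forall F : set G, finite_set F ->
  forall eps : R, 0 < eps ->
  exists B : 'I_k -> set Y, measurable_partition B /\
    forall g, F g -> forall i j : 'I_k,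
      `| fine (mu (a g @` A i `&` A j)) - fine (nu (b g @` B i `&` B j)) | < eps.

Definition profinite_action (G : groupType) (g : G)
    (x : borelType (profinite G)) : borelType (profinite G) :=
  (profinite_eta g * (x : profinite G))%g.

(** [iota] is realized on the real line with the uniform probability on
    [[0, 1]]. *)
Definition iota_profinite_action (R : realType) (G : groupType) (g : G)
    (z : measurableTypeR R * borelType (profinite G)) :
    measurableTypeR R * borelType (profinite G) :=
  (z.1, profinite_action g z.2).

(** Haar measure exists and is unique, so that the existential quantifier on
    [mu] only names it. *)
Definition EMD (R : realType) (G : groupType) : Prop :=
  [/\ countable [set: G], infinite_set [set: G] &
    exists2 mu : probability (borelType (profinite G)) R, is_haar mu &
      forall d (X : measurableType d) (nu : probability X R) (b : G -> X -> X),
        standard_borel R X -> mp_action nu b ->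
        weakly_contained nu b mu (@profinite_action G)].

Definition MD (R : realType) (G : groupType) : Prop :=
  [/\ countable [set: G], infinite_set [set: G] &
    exists2 mu : probability (borelType (profinite G)) R, is_haar mu &
      forall d (X : measurableType d) (nu : probability X R) (b : G -> X -> X),
        standard_borel R X -> mp_action nu b ->
        weakly_contained nu b (uniform_prob (@ltr01 R) \x mu)%E
          (@iota_profinite_action R G)].

(* Main.v *)
Require Import Defs.
From HB Require Import structures.
From mathcomp Require Import all_boot all_order all_algebra.
From mathcomp Require Import fingroup perm generic_quotient.
From mathcomp Require Import all_classical all_reals all_analysis.
From mathcomp Require Import ring lra zify.

Set Implicit Arguments.
Unset Strict Implicit.
Unset Printing Implicit Defensive.

Import Order.TTheory GRing.Theory Num.Theory.
Import numFieldNormedType.Exports.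

Local Open Scope classical_set_scope.
Local Open Scope ring_scope.
Local Open Scope quotient_scope.

(** Call an action on a probability space finitely approximable if the joint
    distributions of any finite labelling under finitely many group elements are
    approximated by those of a labelled finite set on which the group acts.

    Every action of a finite group, and every action of an MD group on a standard
    Borel space, is finitely approximable: up to a small error, the pieces of a
    partition of [[0, 1]] times the profinite completion depend only on the first
    coordinate and on the coset modulo some normal subgroup of finite index, so one
    gets an average of labelled finite quotients, whose weights are then rounded.

    Given an action of the free product, take finite models [T1], [T2] of its
    restrictions to the factors for a labelling that records the values along all
    prefixes of the relevant words.  On [T1 * T2] both models have almost the same
    label frequencies, so after conjugating the second one by a permutation that
    matches the labels they form a finite model of the free product.

    A finite model [T] can be made transitive.  Let [Q1], [Q2] be nontrivial finite
    transitive sets of the factors and let the free product act on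
    [T * Z/M * Q1 * Q2], the action of the second factor being conjugated by a
    permutation which, over one point of [Q1 * Q2] only, shifts [Z/M] and moves to
    the next point of [T] after [M] steps.  A commutator of the factors then runs
    through the whole fibre over that point, while labels are disturbed on a
    proportion [O(1/M)] of the points.  A transitive finite set is a factor of the
    profinite completion, whence EMD.

    An MD group has a nontrivial finite quotient, since otherwise its profinite
    completion is trivial, and no trivial action weakly contains the Bernoulli
    shift.  The Haar measure of the profinite completion comes from the outer
    measure that is the infimum, over open supersets [U], of the supremum over [N]
    of the proportion of cosets of [N] contained in [U]. *)

(** * Actions of free products *)

Definition is_gaction (G : groupType) (T : Type) (a : G -> T -> T) : Prop :=
  (forall x, a 1%g x = x) /\ (forall g h x, a (g * h)%g x = a g (a h x)).

Lemma gactionK (G : groupType) (T : Type) (a : G -> T -> T) : is_gaction a ->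
  forall g, cancel (a g) (a g^-1%g).
Proof. by move=> [a1 aM] g x; rewrite -aM mulVg a1. Qed.

Lemma gactionKV (G : groupType) (T : Type) (a : G -> T -> T) : is_gaction a ->
  forall g, cancel (a g^-1%g) (a g).
Proof. by move=> [a1 aM] g x; rewrite -aM mulgV a1. Qed.

Lemma gaction_inj (G : groupType) (T : Type) (a : G -> T -> T) : is_gaction a ->
  forall g, injective (a g).
Proof. by move=> aact g x y /(congr1 (a g^-1%g)); rewrite !(gactionK aact). Qed.

Section FreeProductAction.
Variables (G1 G2 : groupType) (T : Type).
Variables (a1 : G1 -> T -> T) (a2 : G2 -> T -> T).

Definition fp_letter (l : G1 + G2) : T -> T :=
  match l with inl x => a1 x | inr y => a2 y end.

Definition fp_run (u : fp_word G1 G2) (t : T) : T := foldr fp_letter t u.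

Definition fp_act (g : free_product G1 G2) : T -> T := fp_run (repr g).

Lemma fp_run_cat u v t : fp_run (u ++ v) t = fp_run u (fp_run v t).
Proof. by rewrite /fp_run foldr_cat. Qed.

Hypotheses (act1 : is_gaction a1) (act2 : is_gaction a2).

Lemma fp_run_eq u v : fp_eq u v -> fp_run u =1 fp_run v.
Proof.
elim=> {u v} // [u v _ + t|u v w _ uv _ vw t|u v t|u v t|u v x y t|u v x y t].
- by move=> ->.
- by rewrite uv vw.
- by rewrite !fp_run_cat /= act1.1.
- by rewrite !fp_run_cat /= act2.1.
- by rewrite !fp_run_cat /= act1.2.
- by rewrite !fp_run_cat /= act2.2.
Qed.

Lemma fp_actE u : fp_act (fp_pi u) =1 fp_run u.
Proof. by apply: fp_run_eq; apply/fp_piP; exact: fp_reprK. Qed.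

Lemma fp_act_action : is_gaction fp_act.
Proof.
split=> [x|g h x]; first by rewrite fp_actE.
by rewrite fp_actE fp_run_cat.
Qed.

End FreeProductAction.

Lemma gaction_comp (G H : groupType) (T : Type) (b : H -> T -> T) (h : G -> H) :
  {morph h : x y / (x * y)%g} -> is_gaction b -> is_gaction (b \o h).
Proof.
move=> hM [b1 bM]; split=> [x|x y t] /=; last by rewrite hM bM.
suff -> : h 1%g = 1%g by rewrite b1.
by apply: (@mulgI _ (h 1%g)); rewrite -hM !mulg1.
Qed.

Lemma fp_pi_cat (G1 G2 : groupType) (u v : fp_word G1 G2) :
  fp_pi (u ++ v) = (fp_pi u * fp_pi v)%g.
Proof. by rewrite -fp_mulE. Qed.

(** * Frequencies in finite sets *)

Lemma card_injpre (T : finType) (f : T -> T) (P : pred T) : injective f ->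
  #|[pred x | P (f x)]| = #|P|.
Proof.
move=> fi; rewrite -[LHS](fintype.card_image fi); apply: eq_card => y.
apply/fintype.imageP/idP => [[x Px ->]//|Py].
by exists (invF fi y); rewrite ?inE f_invF.
Qed.

Section Freq.
Variable R : realType.

Definition freq (T : finType) (P : pred T) : R := #|P|%:R / #|T|%:R.

Lemma freq_ge0 (T : finType) (P : pred T) : 0 <= freq P.
Proof. by rewrite divr_ge0. Qed.

Lemma eq_freq (T : finType) (P Q : pred T) : P =1 Q -> freq P = freq Q.
Proof. by move=> PQ; rewrite /freq (eq_card PQ). Qed.

Lemma le_freq (T : finType) (P Q : pred T) :
  (forall x, P x -> Q x) -> freq P <= freq Q.
Proof.
move=> PQ; rewrite /freq ler_wpM2r ?invr_ge0// ler_nat.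
by apply: subset_leq_card; apply/fintype.subsetP => x; exact: PQ.
Qed.

Lemma freq_predT (T : finType) : (0 < #|T|)%N -> freq (T := T) predT = 1.
Proof. by move=> T0; rewrite /freq divff// pnatr_eq0 -lt0n. Qed.

Lemma freq_predU (T : finType) (P Q : pred T) :
  freq [pred x | P x || Q x] <= freq P + freq Q.
Proof.
rewrite /freq -mulrDl ler_wpM2r ?invr_ge0// -natrD ler_nat.
rewrite -(cardUI P Q); exact: leq_addr.
Qed.

Lemma freq_inj (T : finType) (f : T -> T) (P : pred T) : injective f ->
  freq [pred x | P (f x)] = freq P.
Proof. by move=> fi; rewrite /freq card_injpre. Qed.

Lemma freq_sum (T S : finType) (f : T -> S) (P : pred S) :
  freq [pred x | P (f x)] = \sum_(s | P s) freq [pred x | f x == s].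
Proof.
rewrite /freq -mulr_suml; congr (_ / _).
rewrite -natr_sum; congr _%:R.
rewrite -sum1_card (partition_big f P)//=; apply: eq_bigr => s Ps.
rewrite -sum1_card; apply: eq_bigl => x; rewrite !inE.
by case: eqP => [->|]; rewrite ?Ps ?andbF.
Qed.

Lemma freq_exists (T I : finType) (P : I -> pred T) :
  freq [pred x | [exists i, P i x]] <= \sum_i freq (P i).
Proof.
rewrite /freq -mulr_suml ler_wpM2r ?invr_ge0// -natr_sum ler_nat.
rewrite -sum1_card big_mkcond.
apply: (@leq_trans (\sum_x \sum_i P i x)%N).
  apply: leq_sum => x _; rewrite inE; case: ifPn => // /existsP[i Pix].
  by rewrite (bigD1 i)//= Pix.
rewrite exchange_big; apply: leq_sum => i _; rewrite -sum1_card [leqRHS]big_mkcond.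
by apply: leq_sum => x _; rewrite unfold_in; case: (P i x).
Qed.

Lemma freq_dist (T : finType) (P Q B : pred T) :
  (forall x, ~~ B x -> P x = Q x) -> `|freq P - freq Q| <= freq B.
Proof.
move=> PQ; rewrite ler_distl; apply/andP; split.
- rewrite lerBlDr; apply: le_trans (freq_predU P B).
  by apply: le_freq => x /= Qx; case: (boolP (B x)) => [|/PQ ->]; rewrite ?orbT ?Qx.
- apply: le_trans (freq_predU Q B).
  by apply: le_freq => x /= Px; case: (boolP (B x)) => [|/PQ <-]; rewrite ?orbT ?Px.
Qed.

Lemma freq_fst (T U : finType) (P : pred T) : (0 < #|U|)%N ->
  freq [pred x : T * U | P x.1] = freq P.
Proof.
move=> U0; rewrite /freq.
have -> : #|[pred x : T * U | P x.1]| = (#|P| * #|U|)%N.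
  by rewrite -cardX; apply: eq_card => x; rewrite !inE andbT.
by rewrite card_prod !natrM -mulf_div divff ?mulr1// pnatr_eq0 -lt0n.
Qed.

Lemma freq_snd (T U : finType) (P : pred U) : (0 < #|T|)%N ->
  freq [pred x : T * U | P x.2] = freq P.
Proof.
move=> T0; rewrite /freq.
have -> : #|[pred x : T * U | P x.2]| = (#|T| * #|P|)%N.
  by rewrite -cardX; apply: eq_card => x; rewrite !inE.
by rewrite card_prod !natrM -mulf_div divff ?mul1r// pnatr_eq0 -lt0n.
Qed.

End Freq.

(* The subtraction of cardinals is truncated. *)
Lemma matching (T S : finType) (L1 L2 : T -> S) :
  exists p : {perm T}, (#|[pred x | L2 (p x) != L1 x]| <=
    \sum_(s : S) (#|[pred x | L1 x == s]| - #|[pred x | L2 x == s]|))%N.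
Proof.
pose bad (p : {perm T}) := #|[pred x | L2 (p x) != L1 x]|.
case: (@arg_minnP _ (1%g : {perm T}) predT bad isT) => p _ pmin.
exists p; rewrite -sum1_card (partition_big L1 predT)//=; apply: leq_sum => s _.
rewrite sum1_card.
have [x0 /andP[px0 /eqP x0s]|none] :=
  pickP [pred x | (L2 (p x) != L1 x) && (L1 x == s)]; last first.
  by rewrite eq_card0// => x; apply: none.
(* Exchange argument: if [L2 (p x1) = s] but [L1 x1 != s], exchanging the values of [p] at [x0] and
   [x1] repairs [x0] and spoils nothing, as [x1] was mismatched already. This contradicts the
   minimality of [p], so all points of [L2]-label [s] are matched correctly. *)
have noex x1 : L2 (p x1) = s -> L1 x1 = s.
  move=> x1s; apply: contrapT => /eqP x1ns.
  have x01 : x1 != x0 by apply: contraNneq x1ns => ->; rewrite x0s.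
  have := pmin (tperm x0 x1 * p)%g isT; apply/negP; rewrite -ltnNge.
  rewrite /bad; apply: proper_card; apply/fintype.properP; split.
    apply/fintype.subsetP => y; rewrite !inE permM.
    case: tpermP => [->|->|//] //.
    by rewrite x1s (eq_sym s) x1ns.
  by exists x0; rewrite ?inE// permM tpermL x1s x0s eqxx.
have -> : #|[pred x | L2 x == s]| = #|[pred x | (L2 (p x) == L1 x) && (L1 x == s)]|.
  rewrite -(card_injpre [pred x | L2 x == s] (@perm_inj _ p)).
  apply: eq_card => x; rewrite !inE.
  apply/idP/idP => [/eqP xs|/andP[/eqP -> /eqP->]//].
  by rewrite xs noex// eqxx.
rewrite leq_subRL; last by apply/subset_leq_card/fintype.subsetP => x;
  rewrite !inE => /andP[].
rewrite -(cardID [pred x | L2 (p x) == L1 x] [pred x | L1 x == s]).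
rewrite leq_eqVlt; apply/orP; left; apply/eqP; congr addn.
  by apply: eq_card => x; rewrite !inE andbC.
Qed.

(** Repeat each [s] about [K * w s] times, rounded down. The length [M] of the list lies between
    [K - #|S|] and [K], so each frequency is off by at most [#|S| / M], and [K] is chosen with
    [#|S| / (K - #|S|) < e]. *)
Lemma rounding (R : realType) (S : finType) (w : S -> R) (e : R) :
  (forall s, 0 <= w s) -> \sum_s w s = 1 -> 0 < e ->
  exists (n : nat) (f : 'I_n -> S), (0 < n)%N /\
    forall s, `|freq R [pred x | f x == s] - w s| < e.
Proof.
move=> w0 w1 e0.
have S0 : (0 < #|S|)%N.
  rewrite lt0n; apply/negP => /eqP /card0_eq S0; move/eqP: w1.
  by rewrite big1 ?(eq_sym 0) ?oner_eq0// => s; have := S0 s.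
pose c : R := #|S|%:R.
have c1 : 1 <= c by rewrite /c ler1n.
pose K := (Num.truncn (c + c / e)).+1.
have KS : c + c / e < K%:R by apply: truncnS_gt.
have ce : 0 < c / e by rewrite divr_gt0//; lra.
pose n s := Num.truncn (K%:R * w s).
have nle s : (n s)%:R <= K%:R * w s.
  by rewrite /n truncn_le mulr_ge0.
have ngt s : K%:R * w s < (n s)%:R + 1 by rewrite natr1 truncnS_gt.
pose l := flatten [seq nseq (n s) s | s <- enum S].
have cl s : count_mem s l = n s.
  rewrite count_flatten -map_comp sumnE big_map.
  rewrite (bigD1_seq s)/= ?mem_enum ?enum_uniq// big1 ?addn0; first last.
    by move=> t ts; rewrite count_nseq/= (negbTE ts).
  by rewrite count_nseq/= eqxx mul1n.
pose M := size l.
have ME : M = (\sum_s n s)%N.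
  by rewrite /M size_flatten sumnE big_map big_map big_enum;
    apply: eq_bigr => s _; rewrite size_nseq.
have MK : M%:R <= K%:R :> R.
  rewrite ME natr_sum; apply: (@le_trans _ _ (\sum_s (K%:R * w s))).
    by apply: ler_sum.
  by rewrite -mulr_sumr w1 mulr1.
have KM : K%:R - c <= M%:R.
  have -> : K%:R = \sum_s K%:R * w s by rewrite -mulr_sumr w1 mulr1.
  rewrite ME natr_sum lerBlDr.
  have -> : c = \sum_(s : S) 1 by rewrite sumr_const /c.
  by rewrite -big_split; apply: ler_sum => s _ /=; exact/ltW.
have M0 : 0 < M%:R :> R by lra.
exists M, (fun i => tnth (in_tuple l) i); split; first by rewrite -(ltr0n R).
move=> s; rewrite /freq card_ord.
have -> : #|[pred x | tnth (in_tuple l) x == s]| = n s.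
  rewrite -cl -sum1_card -sum1_count (big_tnth _ _ l)/=.
  by apply: eq_bigl => i; rewrite !inE.
have -> : (n s)%:R / M%:R - w s = ((n s)%:R - M%:R * w s) / M%:R.
  by field; rewrite gt_eqF.
rewrite normrM normfV (gtr0_norm M0) ltr_pdivrMr//.
apply: (@le_lt_trans _ _ c); last first.
  rewrite mulrC -ltr_pdivrMr//; lra.
have ws1 : w s <= 1 by rewrite -w1 (bigD1 s)//= lerDl sumr_ge0.
have := nle s; have := ngt s; have := w0 s => A B C.
rewrite ler_norml; apply/andP; split; nra.
Qed.

(** * Labellings of probability spaces *)

Section Pr.
Variables (R : realType) (d : measure_display) (X : measurableType d).
Variable mu : probability X R.

Definition pr (A : set X) : R := fine (mu A).

Lemma pr_fin (A : set X) : measurable A -> (mu A = (pr A)%:E)%E.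
Proof. by move=> mA; rewrite fineK// fin_num_measure. Qed.

Lemma pr_ge0 (A : set X) : 0 <= pr A.
Proof. by rewrite fine_ge0. Qed.

Lemma le_pr (A B : set X) : measurable A -> measurable B -> A `<=` B ->
  pr A <= pr B.
Proof.
move=> mA mB AB; rewrite -lee_fin -!pr_fin//; apply: le_measure => //;
  exact/mem_set.
Qed.

Lemma pr_setT : pr setT = 1.
Proof. by rewrite /pr probability_setT. Qed.

Lemma pr_set0 : pr set0 = 0.
Proof. by rewrite /pr measure0. Qed.

Lemma prU (A B : set X) : measurable A -> measurable B ->
  A `&` B = set0 -> pr (A `|` B) = pr A + pr B.
Proof.
move=> mA mB AB; apply: EFin_inj; rewrite EFinD -!pr_fin//; last exact: measurableU.
by rewrite measureU.
Qed.

Lemma le_prU (A B : set X) : measurable A -> measurable B ->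
  pr (A `|` B) <= pr A + pr B.
Proof.
move=> mA mB; rewrite -lee_fin EFinD -!pr_fin//; last exact: measurableU.
exact: measureU2.
Qed.

Lemma pr_dist (A B C : set X) : measurable A -> measurable B -> measurable C ->
  (forall x, ~ C x -> A x <-> B x) -> `|pr A - pr B| <= pr C.
Proof.
move=> mA mB mC AB; rewrite ler_distl; apply/andP; split.
- rewrite lerBlDr; apply: le_trans (le_prU _ _) => //.
  apply: le_pr => //; first exact: measurableU.
  by move=> x Bx; have [|/AB] := pselect (C x); [right|left; tauto].
- apply: le_trans (le_prU _ _) => //.
  apply: le_pr => //; first exact: measurableU.
  by move=> x Bx; have [|/AB] := pselect (C x); [right|left; tauto].
Qed.

(* A finite measurable partition, given by the map sending a point to the name
   of its piece. *)
Definition labelling (S : finType) (l : X -> S) : Prop :=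
  forall s, measurable (l @^-1` [set s]).

Lemma labelling_measurable (S : finType) (l : X -> S) (P : pred S) :
  labelling l -> measurable [set x | P (l x)].
Proof.
move=> ml;
  rewrite (_ : [set x | P (l x)] = \bigcup_(s in [set s | P s])
  (l @^-1` [set s])).
  by apply: fin_bigcup_measurable.
by apply/seteqP; split=> [x Px|x [s Ps /= ->//]]; exists (l x).
Qed.

Lemma pr_sum (S : finType) (l : X -> S) (P : pred S) : labelling l ->
  pr [set x | P (l x)] = \sum_(s | P s) pr (l @^-1` [set s]).
Proof.
move=> ml; rewrite -big_filter.
have -> : [set x | P (l x)] = [set x | l x \in [seq s <- index_enum S | P s]].
  by apply/seteqP; split=> x /=; rewrite mem_filter mem_index_enum andbT.
have := filter_uniq P (index_enum_uniq S).
elim: [seq _ <- _ | _] => [_|s r IH /= /andP[sr ur]].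
  by rewrite big_nil (_ : [set _ | _] = set0) ?pr_set0// -subset0 => x.
rewrite big_cons -IH// -prU//.
- congr pr; apply/seteqP; split=> x /=; rewrite in_cons.
    by move=> /predU1P.
  by move=> H; apply/predU1P.
- exact: (labelling_measurable [pred s | s \in r]).
- by rewrite -subset0 => x [/= ->]; rewrite (negbTE sr).
Qed.

End Pr.

Section ProductLabel.
Variables (d : measure_display) (X : measurableType d).

Lemma labelling_comp (S S' : finType) (l : X -> S) (f : S -> S') :
  labelling l -> labelling (f \o l).
Proof.
move=> ml s; rewrite (_ : _ @^-1` _ = [set x | [pred t | f t == s] (l x)]);
  last first.
  by apply/seteqP; split=> x /= /eqP.
exact: labelling_measurable.
Qed.

Lemma labelling_ffun (I S : finType) (l : I -> X -> S) :
  (forall i, labelling (l i)) -> labelling (fun x => [ffun i => l i x]).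
Proof.
move=> ml s;
  rewrite (_ : _ @^-1` _ = \bigcap_(i in [set: I]) (l i @^-1` [set s i])).
  by apply: fin_bigcap_measurable => // i _; exact: ml.
apply/seteqP; split=> [x /= <- i _ /=|x /= xs]; first by rewrite ffunE.
by apply/ffunP => i; rewrite ffunE; exact: xs.
Qed.

Lemma labelling_pair (S S' : finType) (l : X -> S) (l' : X -> S') :
  labelling l -> labelling l' -> labelling (fun x => (l x, l' x)).
Proof.
move=> ml ml' [s s'];
  rewrite (_ : _ @^-1` _ = (l @^-1` [set s]) `&` (l' @^-1` [set s'])).
  by apply: measurableI; [exact: ml|exact: ml'].
by apply/seteqP; split=> [x [<- <-]|x [/= -> ->]].
Qed.

Lemma labelling_act d' (Y : measurableType d') (S : finType) (l : X ->
  S) (f : Y -> X) :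
  measurable_fun setT f -> labelling l -> labelling (l \o f).
Proof.
move=> mf ml s; rewrite comp_preimage -[X in measurable X]setTI.
by apply: mf => //; exact: ml.
Qed.

End ProductLabel.

(** Comparing only the labels of [x] and of [g x] is no restriction, since [S] is arbitrary and a
    labelling may itself record the labels of several translates. *)
Definition fin_approx (R : realType) (G : groupType) d (X : measurableType d)
    (mu : probability X R) (b : G -> X -> X) : Prop :=
  forall (S : finType) (l : X -> S), labelling l ->
  forall (F : seq G) (e : R), 0 < e ->
  exists (T : finType) (a : G -> T -> T) (m : T -> S),
    [/\ (0 < #|T|)%N, is_gaction a &
      forall g, g \in F -> forall s s',
        `|pr mu [set x | l x = s /\ l (b g x) = s'] -
          freq R [pred t | (m t == s) && (m (a g t) == s')]| < e].

Lemma fp_act_unique (G1 G2 : groupType) (T : Type) (b : free_product G1 G2 ->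
  T -> T) :
  is_gaction b -> forall u x,
    b (fp_pi u) x = fp_run (b \o @fp_inl G1 G2) (b \o @fp_inr G1 G2) u x.
Proof.
move=> bact; elim=> [|l u IH] x; first exact: bact.1.
rewrite -cat1s fp_pi_cat bact.2 IH.
by case: l.
Qed.

(** * Amalgamating finite models *)

Section WordLabels.
Variables (R : realType) (G1 G2 : groupType) (S : finType).
Variable ws : seq (fp_word G1 G2).
Hypothesis ws_nil : [::] \in ws.
Hypothesis ws_prefix : forall v l, rcons v l \in ws -> v \in ws.

(* The label of [x] records the original label of [u x] for all words [u] of the
   prefix-closed list [ws]: labels of [x] and [l x] then constrain each other, and
   control of single letters propagates to all words of [ws]. *)
Definition wlabel : finType := {ffun seq_sub ws -> S}.

Definition wlabel_at (s : wlabel) (u : fp_word G1 G2) : S :=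
  s (insubd (SeqSub ws_nil) u).

(** Here [s] is meant as the label of a point [p] and [s'] as that of [l p]. The last letter of a
    word acts first, so the entry of [s] at [rcons u l] and the entry of [s'] at [u] describe the
    same point. *)
Definition inconsistent (l : G1 + G2) (s s' : wlabel) : bool :=
  [exists v : seq_sub ws, exists u : seq_sub ws,
    (val v == rcons (val u) l) && (s v != s' u)].

Lemma consistent_at l s s' v : rcons v l \in ws -> ~~ inconsistent l s s' ->
  wlabel_at s (rcons v l) = wlabel_at s' v.
Proof.
move=> vl; apply: contraNeq => neq; apply/existsP.
exists (insubd (SeqSub ws_nil) (rcons v l)); apply/existsP.
by exists (insubd (SeqSub ws_nil) v); rewrite !val_insubd vl (ws_prefix vl) eqxx.
Qed.

Variables (T : finType) (a1 : G1 -> T -> T) (a2 : G2 -> T -> T) (L : T -> wlabel).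
Hypotheses (act1 : is_gaction a1) (act2 : is_gaction a2).
Variable eta : R.
Hypothesis small : forall v l, rcons v l \in ws ->
  freq R [pred p | inconsistent l (L p) (L (fp_letter a1 a2 l p))] <= eta.

(** Read [u] from its last letter. Each letter acts injectively, hence preserves frequencies, so
    every letter adds an error of at most [eta]. *)
Lemma word_error u : u \in ws ->
  freq R [pred p | wlabel_at (L p) u != wlabel_at (L (fp_run a1 a2 u p)) [::]] <=
    (size u)%:R * eta.
Proof.
elim/last_ind: u => [_|v l IH vl].
  by rewrite mul0r /freq eq_card0 ?mul0r// => p; rewrite !inE eqxx.
have linj : injective (fp_letter a1 a2 l).
  by case: (l) => x;
    [exact: (@gaction_inj _ _ _ act1 x)|exact: (@gaction_inj _ _ _ act2 x)].
rewrite size_rcons -nat1r mulrDl mul1r.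
have {}IH := IH (ws_prefix vl).
rewrite -(freq_inj _ _ linj) in IH; apply: le_trans (lerD (small vl) IH).
apply: le_trans (freq_predU _ _ _).
apply: le_freq => p /=; case: (boolP (inconsistent _ _ _)) => //= cons.
by rewrite (consistent_at vl cons) -cats1 fp_run_cat.
Qed.

End WordLabels.

Lemma sum_dist_le (R : realType) (S : finType) (P : pred S) (f g : S -> R) (e : R) :
  0 <= e -> (forall s, P s -> `|f s - g s| <= e) ->
  `|\sum_(s | P s) f s - \sum_(s | P s) g s| <= #|S|%:R * e.
Proof.
move=> e0 fg; rewrite -sumrB; apply: le_trans (ler_norm_sum _ _ _) _.
apply: (@le_trans _ _ (\sum_(s | P s) e)); first exact: ler_sum.
rewrite sumr_const -[leLHS]mulr_natl ler_wpM2r// ler_nat; exact: max_card.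
Qed.

(** Putting the identity into the list of group elements makes the frequencies of single labels
    available too. *)
Lemma fin_approx_freq (R : realType) (G : groupType) d (X : measurableType d)
    (mu : probability X R) (b : G -> X -> X) (S : finType) (l : X -> S)
    (F : seq G) (e : R) :
  fin_approx mu b -> is_gaction b -> labelling l -> 0 < e ->
  exists (T : finType) (a : G -> T -> T) (m : T -> S),
    [/\ (0 < #|T|)%N, is_gaction a,
      forall s, `|pr mu (l @^-1` [set s]) - freq R [pred t | m t == s]| < e &
      forall g, g \in F -> forall s s',
        `|pr mu [set x | l x = s /\ l (b g x) = s'] -
          freq R [pred t | (m t == s) && (m (a g t) == s')]| < e].
Proof.
move=> ab bact ml e0; have [T [a [m [T0 aact am]]]] := ab _ _ ml (1%g :: F) _ e0.
exists T, a, m; split=> // [s|g gF]; last by apply: am; rewrite inE gF orbT.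
have := am 1%g (mem_head _ _) s s; rewrite (_ : [set _ | _] = l @^-1` [set s]);
  last first.
  by apply/seteqP; split=> x /=; rewrite bact.1; tauto.
by rewrite (@eq_freq _ _ _ [pred t | m t == s])// => t /=; rewrite aact.1 andbb.
Qed.

(** Each pair of labels related by [r] has probability 0 on the space, hence frequency at most [e]
    in the model. *)
Lemma fin_approx_incons (R : realType) (G : groupType) d (X : measurableType d)
    (mu : probability X R) (b : G -> X -> X) (S T : finType) (l : X -> S)
    (a : G -> T -> T) (m : T -> S) (g : G) (r : rel S) (e : R) :
  0 <= e ->
  (forall s s', `|pr mu [set x | l x = s /\ l (b g x) = s'] -
          freq R [pred t | (m t == s) && (m (a g t) == s')]| < e) ->
  (forall x, ~~ r (l x) (l (b g x))) ->
  freq R [pred t | r (m t) (m (a g t))] <= (#|S| * #|S|)%:R * e.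
Proof.
move=> e0 am nr.
rewrite (@freq_sum _ _ (S * S)%type (fun t => (m t, m (a g t)))
  [pred q | r q.1 q.2]).
rewrite -card_prod; have := @sum_dist_le R _ [pred q : S * S | r q.1 q.2]
  (fun q => freq R [pred x | (m x, m (a g x)) == q]) (fun=> 0) e e0.
rewrite big1_eq subr0 => H; apply: le_trans (ler_norm _) (H _) => -[s s'] /= rss'.
rewrite subr0 -normrN; have := am s s'; rewrite (_ : [set _ | _] = set0).
  rewrite pr_set0 sub0r => /ltW /(le_trans _); apply; rewrite !normrN.
  by rewrite (@eq_freq _ _ _ [pred t | (m t == s) && (m (a g t) == s')]).
by rewrite -subset0 => x [/= ls ls']; have := nr x; rewrite ls ls' rss'.
Qed.

Section Amalgam.
Variables (R : realType) (G1 G2 : groupType) (d : measure_display).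
Variables (X : measurableType d) (mu : probability X R).
Variable b : free_product G1 G2 -> X -> X.
Hypotheses (bact : is_gaction b) (bm : forall g, measurable_fun setT (b g)).

Lemma amalgam : fin_approx mu (b \o @fp_inl G1 G2) ->
  fin_approx mu (b \o @fp_inr G1 G2) -> fin_approx mu b.
Proof.
move=> approx1 approx2 S l ml F e e0.
(* All prefixes of the chosen words for [1] and for the elements of [F]; [1] is added so that the
   empty word occurs even when [F] is empty. *)
pose ws : seq (fp_word G1 G2) :=
  flatten [seq [seq take n (repr g) | n <- iota 0 (size (repr g)).+1] | g <- 1%g
    :: F].
have wsP u : reflect (exists2 g, g \in 1%g :: F & exists n, u = take n (repr g))
  (u \in ws).
  apply: (iffP flattenP) => [[_ /mapP[g gF ->] /mapP[n _ ->]]|[g gF [n ->]]].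
    by exists g => //; exists n.
  exists [seq take n (repr g) | n <- iota 0 (size (repr g)).+1];
    first by apply/mapP; exists g.
  have [ns|ns] := ltnP n (size (repr g)).+1.
    by apply/mapP; exists n => //; rewrite mem_iota.
  rewrite take_oversize ?(ltnW ns)//; apply/mapP; exists (size (repr g)).
    by rewrite mem_iota /=.
  by rewrite take_size.
have ws_nil : [::] \in ws.
  by apply/wsP; exists 1%g; rewrite ?mem_head//; exists 0%N; rewrite take0.
have ws_prefix v x : rcons v x \in ws -> v \in ws.
  move=> /wsP[g gF [n vx]]; apply/wsP; exists g => //; exists (size v).
  have vn : (size v <= n)%N.
    by have := size_take_min n (repr g); rewrite -vx size_rcons; lia.
  by rewrite -(take_takel _ vn) -vx -cats1 take_size_cat.
have ws_repr g : g \in F -> repr g \in ws.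
  by move=> gF; apply/wsP; exists g; rewrite ?inE ?gF ?orbT//;
    exists (size (repr g)); rewrite take_size.
pose lw (x : X) : wlabel S ws := [ffun u => l (b (fp_pi (val u)) x)].
have mlw : labelling lw.
  by apply: labelling_ffun => u; apply: labelling_act => //; exact: bm.
have lwE x u : u \in ws -> wlabel_at ws_nil (lw x) u = l (b (fp_pi u) x).
  by move=> uws; rewrite /wlabel_at ffunE val_insubd uws.
have lw_cons x y : ~~ inconsistent y (lw x) (lw (b (fp_pi [:: y]) x)).
  apply/negP => /existsP[v /existsP[u /andP[/eqP vu]]].
  by rewrite !ffunE vu -cats1 fp_pi_cat bact.2 eqxx.
pose W := wlabel S ws; pose N : R := #|W|%:R.
have N0 : 0 <= N by rewrite /N.
(* The errors will add up to [N * dl] for the label frequencies and [len * eta] for the words, with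
   [eta] equal to [(N * N + 4 * N) * dl]. This is [C * dl], and [dl] makes it smaller than [e]. *)
pose len : R := (\sum_(g <- F) size (repr g))%:R.
have len0 : 0 <= len by rewrite /len.
pose C := N + len * (N * N + 4 * N).
have C0 : 0 <= C by rewrite /C; nra.
pose dl := e / (C + 1).
have dl0 : 0 < dl by rewrite divr_gt0//; lra.
pose let1 : seq G1 :=
  pmap (fun y => if y is inl x then Some x else None) (flatten ws).
pose let2 : seq G2 :=
  pmap (fun y => if y is inr x then Some x else None) (flatten ws).
have let1P v x : rcons v (inl x) \in ws -> x \in let1.
  move=> vx; rewrite mem_pmap; apply/mapP; exists (inl x) => //.
  by apply/flattenP; exists (rcons v (inl x)); rewrite ?mem_rcons ?mem_head.
have let2P v x : rcons v (inr x) \in ws -> x \in let2.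
  move=> vx; rewrite mem_pmap; apply/mapP; exists (inr x) => //.
  by apply/flattenP; exists (rcons v (inr x)); rewrite ?mem_rcons ?mem_head.
have bact1 := gaction_comp (@fp_inlM G1 G2) bact.
have bact2 := gaction_comp (@fp_inrM G1 G2) bact.
have [T1 [a1 [m1 [T10 act1 fr1 am1]]]] :=
  fin_approx_freq let1 approx1 bact1 mlw dl0.
have [T2 [a2 [m2 [T20 act2 fr2 am2]]]] :=
  fin_approx_freq let2 approx2 bact2 mlw dl0.
pose T : finType := (T1 * T2)%type.
have T0 : (0 < #|T|)%N by rewrite card_prod muln_gt0 T10.
pose L1 (p : T) := m1 p.1; pose L2 (p : T) := m2 p.2.
have [sg sgP] := matching L1 L2.
pose D := [pred p | L2 (sg p) != L1 p].
(* For each label the two frequencies are within [dl] of the same probability, so they differ by at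
   most [2 * dl]; [matching] adds up these differences over the [N] labels. *)
have frD : freq R D <= N * (2 * dl).
  rewrite /freq ler_pdivrMr ?ltr0n//.
  apply: (@le_trans _ _
    ((\sum_s (#|[pred x | L1 x == s]| - #|[pred x | L2 x == s]|))%N)%:R).
    by rewrite ler_nat.
  have -> : N * (2 * dl) * #|T|%:R = \sum_(s : W) (2 * dl * #|T|%:R).
    by rewrite sumr_const -[RHS]mulr_natl -mulrA.
  rewrite natr_sum; apply: ler_sum => s _.
  have E1 : freq R [pred x | L1 x == s] = freq R [pred t | m1 t == s].
    exact: (@freq_fst _ _ _ [pred t | m1 t == s]).
  have E2 : freq R [pred x | L2 x == s] = freq R [pred t | m2 t == s].
    exact: (@freq_snd _ _ _ [pred t | m2 t == s]).
  have dist : freq R [pred x | L1 x == s] - freq R [pred x | L2 x == s] <= 2 * dl.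
    rewrite E1 E2; have := fr1 s; have := fr2 s; rewrite !ltr_norml.
    by move=> /andP[_ A] /andP[B _]; lra.
  have [le12|lt21] := leqP #|[pred x | L1 x == s]| #|[pred x | L2 x == s]|.
    by move: (le12); rewrite -subn_eq0 => /eqP ->;
      rewrite mulr_ge0// mulr_ge0// ltW.
  by rewrite natrB 1?ltnW// -ler_pdivrMr ?ltr0n// mulrBl.
pose b1 (g : G1) (p : T) : T := (a1 g p.1, p.2).
(* Outside [D] the point [sg p] of the second model carries the label that [p] has in the first
   one. *)
pose b2 (g : G2) (p : T) : T := (sg^-1)%g ((sg p).1, a2 g (sg p).2).
have b1act : is_gaction b1.
  by split=> [[x y]|g h [x y]]; rewrite /b1 /= ?act1.1 ?act1.2.
have b2act : is_gaction b2.
  split=> [p|g h p]; rewrite /b2.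
    by rewrite act2.1 -surjective_pairing permK.
  by rewrite permKV /= act2.2.
pose eta := (N * N + 4 * N) * dl.
have small v y : rcons v y \in ws ->
    freq R [pred p | inconsistent y (L1 p) (L1 (fp_letter b1 b2 y p))] <= eta.
  case: y => x vx.
    have : freq R [pred t | inconsistent (inl x) (m1 t) (m1 (a1 x t))] <=
      (N * N) * dl.
      rewrite /N -natrM;
        apply: (fin_approx_incons (r := inconsistent (inl x)) (b :=
        b \o @fp_inl G1 G2)) => //; first exact: ltW.
      exact: am1 (let1P _ _ vx).
    rewrite -(@freq_fst _ _ T2)// => /le_trans; apply.
    by rewrite /eta ler_wpM2r ?(ltW dl0)// lerDl mulr_ge0.
  have : freq R [pred t | inconsistent (inr x) (m2 t) (m2 (a2 x t))] <=
    (N * N) * dl.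
    rewrite /N -natrM;
      apply: (fin_approx_incons (r := inconsistent (inr x)) (b :=
      b \o @fp_inr G1 G2)) => //; first exact: ltW.
    exact: am2 (let2P _ _ vx).
  move=> H; rewrite -(@freq_snd _ T1)// -(freq_inj _ _ (@perm_inj _ sg)) /= in H.
  have b2inj : injective (b2 x) by exact: (gaction_inj b2act).
  (* The label [L1] may be replaced by [L2 \o sg] at [p] and at its image as soon as both avoid [D],
     which costs twice the frequency of [D]. *)
  have DD : freq R [pred p | D p || D (b2 x p)] <= 4 * N * dl.
    apply: le_trans (freq_predU _ _ _) _; rewrite [X in _ + X](freq_inj _ D b2inj).
    have := frD; lra.
  rewrite /eta mulrDl; apply: le_trans (lerD H DD);
    apply: le_trans (freq_predU _ _ _).
  apply: le_freq => p /=; rewrite -/(b2 x p).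
  case: (eqVneq (L2 (sg p)) (L1 p)) => [<-|]; rewrite ?orbT//=.
  case: (eqVneq (L2 (sg (b2 x p))) (L1 (b2 x p))) => [<-|]; rewrite ?orbT//=.
  by rewrite orbF /L2 /b2 permKV.
exists T, (fp_act b1 b2), (fun p => wlabel_at ws_nil (L1 p) [::]).
split=> //; first exact: fp_act_action.
move=> g gF s s'; have gws := ws_repr _ gF.
(* [Q] reads both labels off a single word label. This is exact on the space, and on the model up to
   [word_error]. *)
pose Q :=
  [pred w : W | (wlabel_at ws_nil w [::] == s) &&
  (wlabel_at ws_nil w (repr g) == s')].
have -> : [set x | l x = s /\ l (b g x) = s'] = [set x | Q (lw x)].
  apply/seteqP; split=> x /=; rewrite !lwE// fp_reprK bact.1.
    by move=> [-> ->]; rewrite !eqxx.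
  by move=> /andP[/eqP -> /eqP ->].
rewrite pr_sum// -[X in `|X - _|](subrK (freq R [pred p | Q (L1 p)])) -addrA.
apply: le_lt_trans (ler_normD _ _) _.
apply: (@le_lt_trans _ _ (N * dl + len * eta)); last first.
  have -> : N * dl + len * eta = C * dl by rewrite /C /eta; ring.
  rewrite /dl mulrA ltr_pdivrMr; nra.
apply: lerD.
  rewrite freq_sum; apply: sum_dist_le; first exact: ltW.
  move=> w _; have := fr1 w.
  by rewrite -(@freq_fst _ _ T2 [pred t | m1 t == w])// => /ltW.
apply: (@le_trans _ _ ((size (repr g))%:R * eta)); last first.
  apply: ler_wpM2r; first by rewrite mulr_ge0 ?(ltW dl0)//; nra.
  by rewrite ler_nat (big_rem g)//= leq_addr.
apply: le_trans (word_error ws_nil ws_prefix b1act b2act small gws).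
apply: freq_dist => p /= /negPn/eqP.
by rewrite /Q /= /fp_act => ->.
Qed.

End Amalgam.

(** * Making a finite model transitive *)

Definition gtransitive (G : groupType) (T : Type) (a : G -> T -> T) : Prop :=
  forall x y, exists g, a g x = y.

Section Next.
Variable T : finType.

Definition next_elt (x : T) : T := enum_val (ordS (enum_rank x)).

Lemma next_elt_inj : injective next_elt.
Proof. by move=> x y /enum_val_inj /ordS_inj /enum_rank_inj. Qed.

(** [next_elt] is a single cycle through all of [T]. *)
Lemma next_elt_ind (P : T -> Prop) : (forall x, P x -> P (next_elt x)) ->
  (exists x, P x) -> forall x, P x.
Proof.
move=> Pnext.
have step k (i : 'I_#|T|) : P (enum_val i) -> forall j : 'I_#|T|,
    j = ((i + k) %% #|T|)%N :> nat -> P (enum_val j).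
  move=> Pi; elim: k => [|k IH] j jE.
    by rewrite (_ : j = i)//; apply: val_inj; rewrite /= jE addn0 modn_small.
  have T0 : (0 < #|T|)%N by apply: leq_ltn_trans (ltn_ord i).
  have jk := ltn_pmod (i + k)%N T0.
  rewrite (_ : j = ordS (Ordinal jk)); last first.
    by apply: val_inj; rewrite /= jE -[in RHS]addn1 modnDml addn1 addnS.
  have := Pnext _ (IH (Ordinal jk) erefl).
  by rewrite /next_elt enum_valK.
move=> [x Px] y.
(* The number of steps from [x] to [y] modulo [#|T|], with [#|T|] added so that the truncated
   subtraction is exact. *)
rewrite -[y]enum_rankK;
  apply: (step (#|T| - enum_rank x + enum_rank y)%N (enum_rank x)).
  by rewrite enum_rankK.
by rewrite addnA subnKC 1?ltnW// modnDl modn_small.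
Qed.

End Next.

Section Transitivize.
Variables (G1 G2 : groupType) (T Q1 Q2 : finType).
Variables (a1 : G1 -> T -> T) (a2 : G2 -> T -> T).
Variables (c1 : G1 -> Q1 -> Q1) (c2 : G2 -> Q2 -> Q2).
Hypotheses (a1act : is_gaction a1) (a2act : is_gaction a2).
Hypotheses (c1act : is_gaction c1) (c2act : is_gaction c2).
Hypotheses (c1tr : gtransitive c1) (c2tr : gtransitive c2).
Variables (s1 : G1) (s2 : G2) (e1 : Q1) (e2 : Q2).
Hypotheses (se1 : c1 s1 e1 != e1) (se2 : c2 s2 e2 != e2).
Variable M' : nat.
Let M := M'.+1.
Let W : finType := ((T * 'I_M) * (Q1 * Q2))%type.
Let e : Q1 * Q2 := (e1, e2).

(* [tw_shift] passes to another point of [T] only when the [M]-coordinate wraps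
   around, that is, at [#|T|] points out of [#|T| * M]. *)
Definition tw_shift (p : T * 'I_M) : T * 'I_M :=
  (if p.2 == ord_max then next_elt p.1 else p.1, ordS p.2).

Lemma tw_shift_inj : injective tw_shift.
Proof.
move=> [x i] [y j]; rewrite /tw_shift /= => -[H ij].
have {}ij : i = j by apply: ordS_inj; exact: val_inj.
move: H; rewrite {}ij.
by case: eqP => // _; [move=> /next_elt_inj ->|move=> ->].
Qed.

Definition tw_fun (w : W) : W := if w.2 == e then (tw_shift w.1, w.2) else w.

Lemma tw_fun_inj : injective tw_fun.
Proof.
move=> [p q] [p' q']; rewrite /tw_fun /=.
case: eqP => [->|qe]; case: eqP => [->|qe'] //.
- by move=> /(congr1 fst) /tw_shift_inj /= ->.
- by move=> /(congr1 snd) /= eq; case: qe'.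
- by move=> /(congr1 snd) /= eq; case: qe.
Qed.

Definition tw : {perm W} := perm tw_fun_inj.

Lemma tw_e p : tw (p, e) = (tw_shift p, e).
Proof. by rewrite permE /tw_fun eqxx. Qed.

Lemma tw_ne w : w.2 != e -> tw w = w.
Proof. by rewrite permE /tw_fun => /negbTE ->. Qed.

Lemma twV_ne w : w.2 != e -> (tw^-1)%g w = w.
Proof. by move=> we; rewrite -{1}(tw_ne we) permK. Qed.

Lemma tw_2 w : (tw w).2 = w.2.
Proof. by rewrite permE /tw_fun; case: ifP. Qed.

Lemma twV_2 w : ((tw^-1)%g w).2 = w.2.
Proof. by rewrite -{2}[w](permKV tw) tw_2. Qed.

Definition tw_act1 (g : G1) (w : W) : W :=
  ((a1 g w.1.1, w.1.2), (c1 g w.2.1, w.2.2)).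

Definition tw_base2 (g : G2) (w : W) : W :=
  ((a2 g w.1.1, w.1.2), (w.2.1, c2 g w.2.2)).

Definition tw_act2 (g : G2) (w : W) : W := (tw^-1)%g (tw_base2 g (tw w)).

Lemma tw_act1_action : is_gaction tw_act1.
Proof.
split=> [[[x i] [p q]]|g h [[x i] [p q]]]; rewrite /tw_act1 /=.
  by rewrite a1act.1 c1act.1.
by rewrite a1act.2 c1act.2.
Qed.

Lemma tw_act2_action : is_gaction tw_act2.
Proof.
split=> [w|g h w]; rewrite /tw_act2.
  rewrite (_ : tw_base2 _ _ = tw w) ?permK//.
  by case: (tw w) => -[x i] [p q]; rewrite /tw_base2 /= a2act.1 c2act.1.
by rewrite permKV /tw_base2 /= a2act.2 c2act.2.
Qed.

Let A := fp_act tw_act1 tw_act2.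
Let Aact : is_gaction A := fp_act_action tw_act1_action tw_act2_action.
Let reach x y := exists g, A g x = y.

Let reach_trans y x z : reach x y -> reach y z -> reach x z.
Proof. by move=> [g <-] [h <-]; exists (h * g)%g; rewrite Aact.2. Qed.

Let reach_sym x y : reach x y -> reach y x.
Proof. by move=> [g <-]; exists g^-1%g; rewrite (gactionK Aact). Qed.

Let reach_word u x : reach x (fp_run tw_act1 tw_act2 u x).
Proof.
exists (fp_pi u); apply: fp_actE; [exact: tw_act1_action|exact: tw_act2_action].
Qed.

Definition tw_comm (x : T) : T := a1 s1^-1%g (a2 s2^-1%g (a1 s1 (a2 s2 x))).

(* Around the four-cycle [e, s2 e, s1 s2 e, s1 e] of [Q1 * Q2] the twist is met
   exactly once, so the commutator of [s1] and [s2] advances the [M]-coordinate. *)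
Lemma reach_comm p : reach (p, e) ((tw_comm (tw_shift p).1, (tw_shift p).2), e).
Proof.
have := reach_word [:: inl s1^-1%g; inr s2^-1%g; inl s1; inr s2] (p, e).
have -> : fp_run tw_act1 tw_act2 [:: inl s1^-1%g; inr s2^-1%g; inl s1;
  inr s2] (p, e) =
    tw_act1 s1^-1%g (tw_act2 s2^-1%g (tw_act1 s1 (tw_act2 s2 (p, e)))) by [].
have -> : tw_act2 s2 (p, e) = ((a2 s2 (tw_shift p).1, (tw_shift p).2),
  (e1, c2 s2 e2)).
  by rewrite /tw_act2 tw_e twV_ne// /tw_base2 /= xpair_eqE (negbTE se2) andbF.
rewrite [tw_act1 s1 _]/tw_act1 /= /tw_act2 tw_ne; last first.
  by rewrite xpair_eqE (negbTE se1).
rewrite /tw_base2 /= (gactionK c2act) twV_ne; last first.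
  by rewrite xpair_eqE (negbTE se1).
by rewrite /tw_act1 /= (gactionK c1act).
Qed.

Hypothesis comm_order : forall x, iter M tw_comm x = x.

(** Below the maximal coordinate [tw_shift] does not move the point of [T], so [k] commutators apply
    [tw_comm] exactly [k] times. *)
Let reach_iter x k (kM : (k < M)%N) :
  reach ((x, ord0), e) ((iter k tw_comm x, Ordinal kM), e).
Proof.
elim: k kM => [|k IH] kM /=.
  rewrite (_ : Ordinal kM = ord0); last exact: val_inj.
  by exists 1%g; rewrite Aact.1.
have kM' := ltnW kM.
apply: reach_trans (IH kM') _; have := reach_comm (iter k tw_comm x, Ordinal kM').
rewrite /tw_shift /= ifN; last by apply/eqP => /(congr1 val) /=;
  rewrite /M in kM *; lia.
by rewrite (_ : ordS _ = Ordinal kM)//; apply: val_inj; rewrite /= modn_small.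
Qed.

(** After [M'] commutators the point of [T] is [iter M tw_comm x], that is [x], and the coordinate
    is maximal; the next commutator wraps it around and inserts [next_elt]. *)
Let reach_next x : reach ((tw_comm x, ord0), e) ((tw_comm (next_elt x), ord0), e).
Proof.
have M'M : (M' < M)%N by [].
apply: reach_trans (reach_iter (tw_comm x) M'M) _.
have := reach_comm (iter M' tw_comm (tw_comm x), Ordinal M'M).
rewrite /tw_shift /= ifT; last by apply/eqP/val_inj.
by rewrite -iterSr comm_order (_ : ordS _ = ord0)//; apply: val_inj;
  rewrite /= modnn.
Qed.

Let reach_base x y : reach ((x, ord0), e) ((y, ord0), e).
Proof.
suff H z : reach ((tw_comm (iter M' tw_comm x), ord0), e) ((tw_comm z, ord0), e).
  by have := H (iter M' tw_comm y); rewrite -!iterS !comm_order.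
apply: (next_elt_ind (P := fun z => reach _ ((tw_comm z, ord0), e))).
  by move=> {}z Hz; apply: reach_trans Hz (reach_next z).
by exists (iter M' tw_comm x); exists 1%g; rewrite Aact.1.
Qed.

(** To arrive at [y] with coordinate [k], start from the point which [k] applications of [tw_comm]
    take to [y]. It is [iter (M' * k) tw_comm y], because [M' * k + k] is a multiple of [M]. *)
Let reach_slice x w : w.2 = e -> reach ((x, ord0), e) w.
Proof.
case: w => -[y [k kM]] q /= ->.
have comm_mul n z : iter (M * n) tw_comm z = z.
  by elim: n => [|n IH]; rewrite ?muln0// mulnS iterD IH comm_order.
apply: reach_trans (reach_base x (iter (M' * k) tw_comm y)) _.
by have := reach_iter (iter (M' * k) tw_comm y) kM; rewrite -iterD -mulSn comm_mul.
Qed.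

(** The twist preserves the coordinates in [Q1] and [Q2], on which the factors act transitively, so
    any point can be brought into the fibre over [e]. *)
Lemma tw_transitive : gtransitive A.
Proof.
suff H x w : reach ((x, ord0), e) w.
  move=> w w'; apply: reach_trans (H w.1.1 w'); exact/reach_sym/H.
have [g1 g1e] := c1tr w.2.1 e1; have [g2 g2e] := c2tr w.2.2 e2.
apply: reach_trans (reach_sym (reach_word [:: inr g2; inl g1] w)).
by apply: reach_slice; rewrite /= twV_2 /= tw_2 /= g1e g2e.
Qed.

Variable R : realType.

Let freq_tw : freq R [pred w : W | (tw w).1.1 != w.1.1] <= M%:R^-1.
Proof.
apply: (@le_trans _ _ (freq R [pred w : W | w.1.2 == ord_max])).
  apply: le_freq => w /=; rewrite permE /tw_fun /tw_shift.
  by case: ifP => _ /=; [case: ifP => //|]; rewrite eqxx.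
have Q0 : (0 < #|{: Q1 * Q2}|)%N.
  by rewrite card_prod muln_gt0; apply/andP; split; apply/fintype.card_gt0P;
    [exists e1|exists e2].
have [T0|T0] := posnP #|T|.
  rewrite /freq eq_card0 ?mul0r ?invr_ge0// => -[[x ?] ?].
  by have := card0_eq T0 x.
rewrite (@freq_fst _ _ _ [pred p : T * 'I_M | p.2 == ord_max])//.
rewrite (@freq_snd _ _ _ [pred i : 'I_M | i == ord_max])//.
by rewrite /freq card1 card_ord mul1r.
Qed.

(** The first factor acts on [T] exactly as before. A letter of the second one goes wrong only where
    the twist changes the point of [T] at the source or at the image, whence [2 / M] per letter. *)
Lemma tw_error u :
  freq R [pred w : W | (fp_run tw_act1 tw_act2 u w).1.1 != fp_run a1 a2 u w.1.1]
  <= (size u)%:R * (2 / M%:R).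
Proof.
elim/last_ind: u => [|u l IH].
  by rewrite mul0r /freq eq_card0 ?mul0r// => w; rewrite !inE /= eqxx.
have linj : injective (fp_letter tw_act1 tw_act2 l).
  case: (l) => x; first exact: (gaction_inj tw_act1_action).
  exact: (gaction_inj tw_act2_action).
rewrite size_rcons -nat1r mulrDl mul1r.
rewrite -(freq_inj _ _ linj) in IH.
have bad : freq R [pred w : W | (fp_letter tw_act1 tw_act2 l w).1.1 !=
    fp_letter a1 a2 l w.1.1] <= 2 / M%:R.
  case: l {IH linj} => g /=.
    by rewrite /freq eq_card0 ?mul0r ?divr_ge0// => w; rewrite !inE /= eqxx.
  pose D := [pred w : W | (tw w).1.1 != w.1.1].
  have inj2 : injective (tw_act2 g) by exact: (gaction_inj tw_act2_action).
  have : freq R [pred w | D w || D (tw_act2 g w)] <= 2 / M%:R.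
    apply: le_trans (freq_predU _ _ _) _; rewrite [X in _ + X](freq_inj _ D inj2).
    have := freq_tw; rewrite -/D; set x := freq R D; set y := M%:R^-1; lra.
  apply: le_trans; apply: le_freq => w /=.
  case: (eqVneq (tw w).1.1 w.1.1) => //= <-.
  by rewrite /tw_act2 permKV /tw_base2 /= eq_sym.
apply: le_trans (lerD bad IH); apply: le_trans (freq_predU _ _ _).
apply: le_freq => w /=; rewrite -cats1 !fp_run_cat /=.
by case: (eqVneq (fp_letter tw_act1 tw_act2 l w).1.1 (fp_letter a1 a2 l w.1.1))
  => //= <-.
Qed.

End Transitivize.

(** The lower bound [K] on the size serves to show that the free product is infinite. *)
Lemma transitivize (R : realType) (G1 G2 : groupType) (T Q1 Q2 S : finType)
    (a1 : G1 -> T -> T) (a2 : G2 -> T -> T) (m : T -> S)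
    (c1 : G1 -> Q1 -> Q1) (c2 : G2 -> Q2 -> Q2)
    (F : seq (free_product G1 G2)) (eps : R) (K : nat) :
  is_gaction a1 -> is_gaction a2 -> is_gaction c1 -> is_gaction c2 ->
  gtransitive c1 -> gtransitive c2 -> (1 < #|Q1|)%N -> (1 < #|Q2|)%N ->
  (0 < #|T|)%N -> 0 < eps ->
  exists (W : finType) (a : free_product G1 G2 -> W -> W) (m' : W -> S),
    [/\ (K < #|W|)%N, is_gaction a, gtransitive a &
      forall g, g \in F -> forall s s',
        `|freq R [pred t | (m t == s) && (m (fp_act a1 a2 g t) == s')] -
          freq R [pred w | (m' w == s) && (m' (a g w) == s')]| < eps].
Proof.
move=> a1act a2act c1act c2act c1tr c2tr Q12 Q22 T0 eps0.
have moves (G : groupType) (Q : finType) (c : G -> Q -> Q) : (1 < #|Q|)%N ->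
    gtransitive c -> exists s x, c s x != x.
  by move=> /fintype.card_gt1P[x [y [_ _ xy]]] /(_ x y)[s sx]; exists s, x;
    rewrite sx eq_sym.
have [s1 [e1 se1]] := moves _ _ _ Q12 c1tr.
have [s2 [e2 se2]] := moves _ _ _ Q22 c2tr.
have comm_inj : injective (tw_comm a1 a2 s1 s2).
  move=> x y /(gaction_inj a1act) /(gaction_inj a2act).
  by move=> /(gaction_inj a1act) /(gaction_inj a2act).
pose cp : {perm T} := perm comm_inj.
pose L := (\sum_(g <- F) size (repr g))%N.
(* A multiple of the order of the commutator on [T], as [comm_order] demands, and so large that
   [L * (2 / M) < eps] and [K < #|W|]. *)
pose M := (#[cp]%g * (Num.truncn (2 * L%:R / eps) + K).+1)%N.
have M0 : (0 < M)%N by rewrite muln_gt0 order_gt0.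
have MM : M.-1.+1 = M by rewrite prednK.
have comm_order x : iter M.-1.+1 (tw_comm a1 a2 s1 s2) x = x.
  rewrite MM (eq_iter (fun y => esym (permE comm_inj y))) -permX.
  by rewrite expgM expg_order expg1n perm1.
have Mbig : ((Num.truncn (2 * L%:R / eps) + K).+1 <= M)%N.
  by rewrite leq_pmull// order_gt0.
exists ((T * 'I_M.-1.+1) * (Q1 * Q2))%type.
exists (fp_act (tw_act1 (M' := M.-1) a1 c1) (tw_act2 (M' := M.-1) a2 c2 e1 e2)).
exists (fun w => m w.1.1); split.
- rewrite !card_prod card_ord MM.
  have Q0 : (0 < #|T| * (#|Q1| * #|Q2|))%N by rewrite !muln_gt0 T0 (ltnW Q12)
    (ltnW Q22).
  move: Mbig Q0; nia.
- by apply: fp_act_action; [exact: tw_act1_action|exact: tw_act2_action].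
- exact: (tw_transitive a1act a2act c1act c2act c1tr c2tr se1 se2).
move=> g gF s s'.
have : `|freq R [pred w : (T * 'I_M.-1.+1) * (Q1 * Q2) |
     (m w.1.1 == s) && (m (fp_act a1 a2 g w.1.1) == s')] -
   freq R [pred w : (T * 'I_M.-1.+1) * (Q1 * Q2) | (m w.1.1 == s) &&
     (m (fp_act (tw_act1 (M' := M.-1) a1 c1) (tw_act2 (M' := M.-1) a2 c2 e1 e2)
       g w).1.1 == s')]|
   <= L%:R * (2 / M%:R).
  apply: le_trans (_ : (size (repr g))%:R * (2 / M%:R) <= _); last first.
    by rewrite ler_wpM2r ?divr_ge0// ler_nat /L (big_rem g)//= leq_addr.
  rewrite -[in leRHS]MM.
  apply: le_trans (tw_error a1act a2act c1act c2act e1 e2 M.-1 R (repr g)).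
  by apply: freq_dist => w /= /negPn/eqP; rewrite /fp_act => ->.
rewrite (@freq_fst _ _ _ [pred p : T * 'I_M.-1.+1 | (m p.1 == s) &&
  (m (fp_act a1 a2 g p.1) == s')]); last first.
  by rewrite card_prod muln_gt0 (ltnW Q12) (ltnW Q22).
rewrite (@freq_fst _ _ _ [pred t | (m t == s) && (m (fp_act a1 a2 g t) == s')])
  ?card_ord//.
move=> /le_lt_trans; apply.
have : 2 * L%:R / eps < M%:R.
  apply: lt_le_trans (truncnS_gt _) _; rewrite ler_nat; apply: leq_trans Mbig.
  by rewrite ltnS leq_addr.
by rewrite mulrA !ltr_pdivrMr ?ltr0n// mulrC (mulrC eps).
Qed.

(** * The profinite completion *)

Section FinNormal.
Variable G : groupType.
Implicit Types (N M : fin_normal G) (x y : profinite G).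

Lemma coset_left_eq N (g h : G) :
  coset_left g N = coset_left h N <-> fn_set N (g^-1 * h)%g.
Proof.
split=> [gh|Ngh].
  have : coset_left g N h by rewrite gh; exists 1%g; rewrite ?mulg1//; exact: fn1.
  by move=> [n Nn <-]; rewrite mulKg.
apply/seteqP; split=> _ [n Nn <-].
  exists (h^-1 * g * n)%g; last by rewrite -mulgA mulVKg.
  by apply: fnM => //; have := fnV Ngh; rewrite invgM invgK.
exists (g^-1 * h * n)%g; last by rewrite -mulgA mulVKg.
exact: fnM.
Qed.

Lemma coset_left_refl N g : coset_left g N g.
Proof. by exists 1%g; [exact: fn1|rewrite mulg1]. Qed.

Lemma coset_leftI N M (g : G) :
  coset_left g (N `&` M) = coset_left g N `&` coset_left g M.
Proof.
apply/seteqP; split=> [_ [n [Nn Mn] <-]|z [[n Nn <-] [m Mm]]].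
  by split; exists n.
by move/mulgI => mn; exists n => //; split=> //; rewrite -mn.
Qed.

Definition fnI N M : fin_normal G.
Proof.
apply: (@FinNormal _ (N `&` M)).
- by split; exact: fn1.
- by move=> x y [? ?] [? ?]; split; exact: fnM.
- by move=> x [? ?]; split; exact: fnV.
- by move=> x y [? ?]; split; exact: fnJ.
- apply: (@sub_finite_set _ _
  [set A `&` B | A in [set coset_left g N | g in [set: G]]
    & B in [set coset_left g M | g in [set: G]]]).
    move=> _ [g _ <-]; exists (coset_left g N); first by exists g.
    by exists (coset_left g M); [exists g|rewrite -coset_leftI].
  by apply: finite_image2; exact: fn_index.
Defined.

Definition fnT : fin_normal G.
Proof.
apply: (@FinNormal _ [set: G]) => //.
apply: (@sub_finite_set _ _ [set [set: G]]); last exact: finite_set1.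
move=> _ [g _ <-]; apply/seteqP; split=> // x _.
by exists (g^-1 * x)%g => //; rewrite mulVKg.
Defined.

Lemma fn_bigI (Ns : seq (fin_normal G)) :
  exists N, forall M, M \in Ns -> N `<=` M.
Proof.
elim: Ns => [|M Ns [N NNs]]; first by exists fnT.
exists (fnI M N) => M'; rewrite inE => /predU1P[-> //|/NNs NM'];
  first by move=> x [].
by move=> x [_ /NM'].
Qed.

Lemma pf_val_sub N M x g : N `<=` M -> pf_val x N = coset_left g N ->
  pf_val x M = coset_left g M.
Proof.
move=> NM xN; have [h xM] := pf_coset x M; rewrite xM.
apply/coset_left_eq.
have : coset_left h M g.
  by rewrite -xM; apply: (pf_valP x).2 NM _ _; rewrite xN; exact: coset_left_refl.
by move=> [m Mm <-]; rewrite mulKg.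
Qed.

(** The coset, containing [x], of the kernel of the projection to [G / N]. *)
Definition cyl N x : set (profinite G) := [set y | pf_val y N = pf_val x N].

Lemma cyl_refl N x : cyl N x x. Proof. by []. Qed.

Lemma cyl_sub N M x : N `<=` M -> cyl N x `<=` cyl M x.
Proof.
move=> NM y yN; have [g xg] := pf_coset x N.
by rewrite /cyl /= (pf_val_sub NM xg) (pf_val_sub NM (etrans yN xg)).
Qed.

Lemma cyl_nbhs N x : nbhs x (cyl N x).
Proof.
pose K (_ : fin_normal G) : topologicalType := discrete_topology (set G).
have c1 : {for x, continuous (set_val : profinite G -> prod_topology K)}.
  exact: initial_continuous.
have c2 := @proj_continuous _ K N (set_val x).
by apply:
  (continuous_comp c1 c2
  (discrete_set1 (pf_val x N : discrete_topology (set G)))).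
Qed.

(** A basic neighbourhood in a product of discrete spaces fixes finitely many coordinates, and the
    coordinate at the intersection of the subgroups determines all of these. *)
Lemma nbhs_cyl x (A : set (profinite G)) : nbhs x A <-> exists N, cyl N x `<=` A.
Proof.
split; last by move=> [N NA]; apply: (filterS NA); exact: cyl_nbhs.
pose F := filter_from [set: fin_normal G] (cyl ^~ x).
have FF : Filter F.
  apply: filter_from_filter; first by exists fnT.
  move=> N M _ _; exists (fnI N M) => // y yNM.
  by split; apply: cyl_sub yNM => z [].
suff FA : nbhs x `<=` F by move=> /FA [N _]; exists N.
move=> {}A [U [[V oV VU] Ux] UA].
have FV : (set_val @ F) -->
  (set_val x :
  prod_topology (fun _ : fin_normal G => discrete_topology (set G))).
  apply/cvg_sup => N B.
  move=> [C [[D oD <-] Dx] CB]; exists N => // y yN; apply: CB => /=.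
  by change (D (pf_val y N)); rewrite yN.
have /FV [N _ NV] : nbhs (set_val x) V by apply: open_nbhs_nbhs; split => //;
  move: Ux; rewrite -VU.
by exists N => // y yN; apply: UA; rewrite -VU; exact: NV.
Qed.

Lemma cyl_trans N x y z : cyl N x y -> cyl N y z -> cyl N x z.
Proof. by rewrite /cyl /= => -> ->. Qed.

Lemma cyl_sym N x y : cyl N x y -> cyl N y x.
Proof. by rewrite /cyl /= => ->. Qed.

Lemma open_cylP (U : set (profinite G)) :
  open U <-> forall x, U x -> exists N, cyl N x `<=` U.
Proof.
rewrite openE; split=> [oU x /oU /nbhs_cyl//|H x /H /nbhs_cyl //].
Qed.

Lemma cyl_open N x : open (cyl N x).
Proof. by apply/open_cylP => y xy; exists N => z; exact: cyl_trans. Qed.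

Lemma profinite_hausdorff : hausdorff_space (profinite G).
Proof.
move=> x y xy; apply: pf_inj => N.
have [z [zx zy]] := xy _ _ (cyl_nbhs N x) (cyl_nbhs N y).
by rewrite -zx zy.
Qed.

Lemma ultra_fin_image (T : Type) (U : eqType) (F : set_system T) (f : T ->
  U) (s : seq U) :
  UltraFilter F -> (forall t, f t \in s) -> exists2 u,
    u \in s & F (f @^-1` [set u]).
Proof.
move=> FU fs; apply: contrapT => nex.
suff H (r : seq U) : {subset r <= s} -> F [set t | f t \notin r].
  have := filter_ex (H s (fun _ => id)) => -[t]; by rewrite /= fs.
elim: r => [|u r IH] rs; first by apply: (filterS _ filterT) => t.
have us : u \in s by apply: rs; rewrite mem_head.
have [Fu|Fu] := in_ultra_setVsetC (f @^-1` [set u]) FU.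
  by case: nex; exists u.
have Fr : F [set t | f t \notin r] by apply: IH => v vr; apply: rs;
  rewrite inE vr orbT.
apply: filterS (filterI Fu Fr) => t [/= /eqP tu tr].
by rewrite inE negb_or tu.
Qed.

(** An ultrafilter selects one coset of every [N]. The selected cosets are compatible because any
    two sets of the filter meet. *)
Lemma profinite_compact : compact [set: profinite G].
Proof.
rewrite compact_ultra => F FU _.
have lim N : exists g, F [set y | pf_val y N = coset_left g N].
  have /finite_seqP[s sE] := fn_index N.
  have sP (y : profinite G) : pf_val y N \in s.
    have [g ->] := pf_coset y N.
    by have : [set` s] (coset_left g N) by rewrite -sE; exists g.
  have [c cs Fc] := ultra_fin_image FU sP.
  have : [set` s] c by [].
  by rewrite -sE => -[g _ gc]; exists g; rewrite gc.
have [x xP] := choice lim.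
have xset : profinite_set (fun N : fin_normal G => coset_left (x N) N).
  split=> [N|N M NM]; first by exists (x N).
  have [y [yN yM]] := filter_ex (filterI (xP N) (xP M)).
  by rewrite -yN -yM; exact: (pf_valP y).2.
exists (pf_mk xset); split=> // A /nbhs_cyl[N NA].
exact: filterS NA (xP N).
Qed.

Lemma profinite_closed_compact (A : set (profinite G)) : closed A -> compact A.
Proof. by move=> cA; apply: subclosed_compact cA profinite_compact _. Qed.

(* Lebesgue number lemma, with [N] in the role of the number. *)
Lemma cyl_uniform (I : eqType) (i0 : I) (U : I -> set (profinite G))
  (K : set (profinite G)) :
  compact K -> (forall i, open (U i)) -> K `<=` \bigcup_i U i ->
  exists N (s : seq I), forall x, K x -> exists2 i, i \in s & cyl N x `<=` U i.
Proof.
move=> cK oU KU.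
have ch (x : profinite G) : exists iN : I * fin_normal G, K x ->
  cyl iN.2 x `<=` U iN.1.
  have [Kx|nKx] := pselect (K x); last first.
    by exists (i0, fnT).
  have [i _ Ux] := KU _ Kx.
  by have /open_cylP /(_ _ Ux) [N NU] := oU i; exists (i, N).
have {ch} [f fP] := choice ch.
move: cK; rewrite compact_cover => /(_ (profinite G) K (fun x => cyl (f x).2 x)).
case=> [x _|x Kx|D DK Dcov]; [exact: cyl_open|by exists x|].
have [N NN] := fn_bigI [seq (f x).2 | x <- finmap.enum_fset D].
exists N, [seq (f x).1 | x <- finmap.enum_fset D] => y /Dcov [x /= xD xy].
exists (f x).1; first by apply/mapP; exists x.
apply: subset_trans (fP x _); last by have := DK _ xD; rewrite inE.
move=> z /(cyl_sub _) yz; apply: cyl_trans xy _; apply: yz; apply: NN.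
by apply/mapP; exists x.
Qed.


(** * Finite quotients of the profinite completion *)

Definition fn_cosets N : seq (set G) := sval (cid ((finite_seqP _).1 (fn_index N))).

Lemma pf_val_fn_cosets N x : pf_val x N \in fn_cosets N.
Proof.
have [g ->] := pf_coset x N.
rewrite /fn_cosets; case: cid => s /= sE.
by have : [set` s] (coset_left g N) by rewrite -sE; exists g.
Qed.

Definition quot N : finType := seq_sub (fn_cosets N).

Definition pf_proj N x : quot N := SeqSub (pf_val_fn_cosets N x).

Lemma pf_projP N x y : pf_proj N x = pf_proj N y <-> cyl N y x.
Proof.
split=> [/(congr1 val) //|xy]; exact: val_inj.
Qed.

Lemma pf_proj_eta_surj N (c : quot N) : exists g, pf_proj N (profinite_eta g) = c.
Proof.
case: c => c cN; have : exists g, coset_left g N = c.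
  move: cN; rewrite /fn_cosets; case: cid => s /= sE cs.
  by have : [set` s] c by []; rewrite -sE => -[g _ gc]; exists g.
by move=> [g gc]; exists g; apply: val_inj.
Qed.

Definition quot_lift N (c : quot N) : profinite G :=
  profinite_eta (sval (cid (pf_proj_eta_surj c))).

Lemma quot_liftK N (c : quot N) : pf_proj N (quot_lift c) = c.
Proof. by rewrite /quot_lift; case: cid. Qed.

(** Left translation on [G / N] through the projection of the completion; by [pf_projM] the choice
    of the lift does not affect the result. *)
Definition quot_act N (x : profinite G) (c : quot N) : quot N :=
  pf_proj N (x * quot_lift c)%g.

Lemma cyl_mul N x x' y y' : cyl N x x' -> cyl N y y' -> cyl N (x * y)%g (x' * y')%g.
Proof.
have [g xg] := pf_coset x N; have [h yh] := pf_coset y N.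
move=> xx' yy'; rewrite /cyl /= (pf_mulE xg yh); apply: pf_mulE.
  by rewrite -xg.
by rewrite -yh.
Qed.

Lemma pf_projM N x y : pf_proj N (x * y)%g = quot_act x (pf_proj N y).
Proof.
apply/pf_projP/cyl_sym; apply: cyl_mul => //.
by apply/pf_projP; rewrite quot_liftK.
Qed.

Lemma quot_act_action N : is_gaction (@quot_act N).
Proof.
split=> [c|x y c]; first by rewrite /quot_act mul1g quot_liftK.
by rewrite {1}/quot_act -mulgA pf_projM.
Qed.

Lemma quot_act_transitive N : gtransitive (@quot_act N).
Proof.
move=> c c'; exists (quot_lift c' * (quot_lift c)^-1)%g.
by rewrite /quot_act mulgKV quot_liftK.
Qed.

Lemma quot_gt0 N : (0 < #|quot N|)%N.
Proof. by apply/fintype.card_gt0P; exists (pf_proj N 1%g). Qed.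

Lemma quot_eta_action N :
  is_gaction (fun (g : G) (c : quot N) => quot_act (profinite_eta g) c).
Proof. exact: gaction_comp (@profinite_etaM G) (@quot_act_action N). Qed.

Definition quot_map N M (c : quot N) : quot M := pf_proj M (quot_lift c).

Lemma quot_mapE N M x : N `<=` M -> quot_map M (pf_proj N x) = pf_proj M x.
Proof.
move=> NM; apply/pf_projP; apply: cyl_sub NM _ _.
by apply/pf_projP; rewrite quot_liftK.
Qed.

Lemma cyl_saturated_open N (K : set (profinite G)) :
  (forall x y, cyl N x y -> K x -> K y) -> open K.
Proof. by move=> sat; apply/open_cylP => x Kx; exists N => y /sat; apply. Qed.

Lemma profinite_mul_open x (U : set (profinite G)) : open U ->
  open [set (x * y)%g | y in U].
Proof.
move=> /open_cylP oU; apply/open_cylP => _ [y Uy <-].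
have [N NU] := oU _ Uy; exists N => z xyz; exists (x^-1 * z)%g;
  last by rewrite mulVKg.
by apply: NU; rewrite -[X in cyl _ X](mulKg x y); exact: cyl_mul.
Qed.

End FinNormal.

(** Group elements map fibres of [f] into fibres, so by transitivity of the target all fibres have
    the same size [k]. *)
Lemma freq_equivariant (R : realType) (G : groupType) (A B : finType)
    (a : G -> A -> A) (b : G -> B -> B) (f : A -> B) (P : pred B) :
  is_gaction a -> gtransitive b -> (0 < #|A|)%N ->
  (forall g x, f (a g x) = b g (f x)) ->
  freq R [pred x | P (f x)] = freq R P.
Proof.
move=> aact btr /fintype.card_gt0P[x0 _] fab.
pose k := #|[pred x | f x == f x0]|.
have fib y : #|[pred x | f x == y]| = k.
  have le y1 y2 : (#|[pred x | f x == y1]| <= #|[pred x | f x == y2]|)%N.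
    have [g gy] := btr y1 y2.
    rewrite -(fintype.card_image (@gaction_inj _ _ _ aact g)).
    apply/subset_leq_card/fintype.subsetP => z /fintype.imageP[x];
      rewrite !inE => /eqP fx ->.
    by rewrite fab fx gy.
  by apply/eqP; rewrite eqn_leq !le.
have cardP (Q : pred B) : #|[pred x | Q (f x)]| = (#|Q| * k)%N.
  rewrite -[LHS]sum1_card (partition_big f Q)//= -sum_nat_const.
  apply: eq_bigr => y Qy; rewrite -(fib y) -[RHS]sum1_card; apply: eq_bigl => x.
  by rewrite !inE; case: eqP => [->|]; rewrite ?andbF// andbT.
have k0 : (0 < k)%N by apply/fintype.card_gt0P; exists x0; rewrite inE.
have -> : freq R [pred x | P (f x)] = (#|P| * k)%:R / (#|B| * k)%:R.
  rewrite /freq cardP; congr (_ / _%:R); rewrite -(cardP predT).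
  exact: eq_card.
by rewrite !natrM -mulf_div divff ?mulr1// pnatr_eq0 -lt0n.
Qed.

(** * Haar measure *)

Section Haar.
Variables (R : realType) (G : groupType).
Implicit Types (N M : fin_normal G) (x y : profinite G)
  (A U V K : set (profinite G)).

Definition mass N A : R :=
  freq R [pred c : quot N | `[< forall x, pf_proj N x = c -> A x >]].

Lemma mass_ge0 N A : 0 <= mass N A.
Proof. exact: freq_ge0. Qed.

Lemma mass_le1 N A : mass N A <= 1.
Proof. by rewrite -(freq_predT R (quot_gt0 N)); exact: le_freq. Qed.

Lemma mass_setT N : mass N setT = 1.
Proof.
by rewrite -(freq_predT R (quot_gt0 N)); apply: eq_freq => c; apply/asboolP.
Qed.

Lemma le_mass N A B : A `<=` B -> mass N A <= mass N B.
Proof.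
by move=> AB; apply: le_freq => c /= /asboolP H; apply/asboolP => x /H /AB.
Qed.

Definition saturated N A := forall x y, cyl N x y -> A x -> A y.

Definition core N A : set (profinite G) := [set x | cyl N x `<=` A].

Lemma core_saturated N A : saturated N (core N A).
Proof. by move=> x y xy xA z yz; apply: xA; exact: cyl_trans xy yz. Qed.

Lemma core_sub N A : core N A `<=` A.
Proof. by move=> x; apply; exact: cyl_refl. Qed.

Lemma saturated_sub N M A : N `<=` M -> saturated M A -> saturated N A.
Proof. by move=> NM sat x y /(cyl_sub NM) /sat. Qed.

Lemma saturatedC N A : saturated N A -> saturated N (~` A).
Proof. by move=> sat x y /cyl_sym yx nAx /(sat _ _ yx). Qed.

Lemma mass_core N A : mass N (core N A) = mass N A.
Proof.
apply/eqP; rewrite eq_le le_mass ?andbT//=; last exact: core_sub.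
apply: le_freq => c /= /asboolP cA; apply/asboolP => x xc y xy; apply: cA.
by rewrite -xc; apply/pf_projP.
Qed.

Lemma saturated_mass N A (sat : saturated N A) x :
  `[< forall y, pf_proj N y = pf_proj N x -> A y >] = `[< A x >].
Proof.
apply/asboolP/asboolP => [|Ax y /pf_projP xy]; first exact.
exact: sat xy Ax.
Qed.

(** The projection from [G / N] to [G / M] is equivariant under the completion, so
    [freq_equivariant] applies. *)
Lemma mass_refine N M A : N `<=` M -> saturated M A -> mass N A = mass M A.
Proof.
move=> NM sat; rewrite /mass.
have rE x : quot_map M (pf_proj N x) = pf_proj M x by exact: quot_mapE.
have rM x (c : quot N) : quot_map M (quot_act x c) = quot_act x (quot_map M c).
  by rewrite -(quot_liftK c) -pf_projM !rE pf_projM.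
rewrite -(freq_equivariant R _ (@quot_act_action _ N) (@quot_act_transitive _ M)
  (quot_gt0 N) rM).
apply: eq_freq => c /=; rewrite -(quot_liftK c) rE !saturated_mass//.
exact: saturated_sub sat.
Qed.

(** Every coset of [N] lies either in the saturated set [K] or in its complement. *)
Lemma mass_add N U K : saturated N K -> K `<=` U ->
  mass N U = mass N K + mass N (U `\` K).
Proof.
move=> sat KU; rewrite /mass /freq -mulrDl -natrD; congr (_%:R / _).
rewrite -(cardID [pred c | `[< forall x, pf_proj N x = c -> K x >]]); congr addn.
  apply: eq_card => c; rewrite !inE; apply/andP/asboolP => [[_ /asboolP//]|cK].
  by split; apply/asboolP => x /cK // /KU.
apply: eq_card => c; rewrite !inE -(quot_liftK c) saturated_mass//.
apply/andP/asboolP => [[/asboolP nK /asboolP cU] x xc|H].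
  split; first exact: cU.
  by move=> Kx; apply: nK; apply: sat Kx; apply/pf_projP.
split; first by apply/asboolP; have [] := H _ erefl.
by apply/asboolP => x /H [].
Qed.

Lemma le_mass_refine N M U : N `<=` M -> mass M U <= mass N U.
Proof.
move=> NM; rewrite -(mass_core M U) -(mass_refine NM (@core_saturated M U)).
by apply: le_mass; exact: core_sub.
Qed.

Definition omass U : R := sup [set mass N U | N in [set: fin_normal G]].

Lemma omass_has_sup U : has_sup [set mass N U | N in [set: fin_normal G]].
Proof.
split; first by exists (mass (fnT G) U); exists (fnT G).
by exists 1 => _ [N _ <-]; exact: mass_le1.
Qed.

Lemma mass_le_omass N U : mass N U <= omass U.
Proof. by apply: (sup_upper_bound (omass_has_sup U)); exists N. Qed.

Lemma omass_le U r : (forall N, mass N U <= r) -> omass U <= r.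
Proof.
move=> Ur; apply: ge_sup; first exact: (omass_has_sup U).1.
by move=> _ [N _ <-].
Qed.

Lemma omass_ge0 U : 0 <= omass U.
Proof. exact: le_trans (mass_ge0 (fnT G) U) (mass_le_omass _ _). Qed.

Lemma le_omass U V : U `<=` V -> omass U <= omass V.
Proof.
by move=> UV; apply: omass_le => N;
  apply: le_trans (le_mass N UV) (mass_le_omass _ _).
Qed.

Lemma omass_setT : omass setT = 1.
Proof.
apply/eqP; rewrite eq_le omass_le//=; last by move=> N; exact: mass_le1.
by rewrite -(mass_setT (fnT G)) mass_le_omass.
Qed.

Lemma omass_set0 : omass set0 = 0.
Proof.
apply/eqP; rewrite eq_le omass_ge0 andbT; apply: omass_le => N.
rewrite /mass /freq eq_card0 ?mul0r// => c; rewrite !inE.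
by apply/asboolP => /(_ _ (quot_liftK c)).
Qed.

(** The set [core N U] is clopen, hence compact, so for some [M] all cylinders of [M] around its
    points lie in one of finitely many [V i]. The rest is a union bound for the cosets of
    [fnI N M]. *)
Lemma omass_subadd (U : set (profinite G)) (V : (set (profinite G))^nat) :
  open U -> (forall n, open (V n)) -> U `<=` \bigcup_n V n ->
  ((omass U)%:E <= \sum_(i <oo) (omass (V i))%:E)%E.
Proof.
move=> oU oV UV.
suff H N : ((mass N U)%:E <= \sum_(i <oo) (omass (V i))%:E)%E.
  have -> : (omass U)%:E =
    ereal_sup (EFin @` [set mass N U | N in [set: fin_normal G]]).
    by rewrite ereal_sup_EFin//; have [] := omass_has_sup U.
  by apply: ge_ereal_sup => _ [_ [N _ <-] <-].
have cK : compact (core N U).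
  apply: profinite_closed_compact; rewrite -openC.
  by apply: (@cyl_saturated_open _ N); apply: saturatedC; exact: core_saturated.
have [M [s sP]] := cyl_uniform 0%N cK oV (subset_trans (@core_sub N U) UV).
pose NM := fnI N M.
pose n := (\max_(i <- s) i).+1.
apply: (@le_trans _ _ (\sum_(0 <= i < n) (omass (V i))%:E)%E); last first.
  by apply: nneseries_lim_ge => i _ _; rewrite lee_fin omass_ge0.
rewrite sumEFin lee_fin -mass_core.
have NMN : NM `<=` N by move=> z [].
rewrite -(mass_refine NMN (@core_saturated N U)).
apply: (@le_trans _ _ (\sum_(0 <= i < n) mass NM (V i))); last first.
  by apply: ler_sum => i _; exact: mass_le_omass.
rewrite big_mkord.
apply: (@le_trans _ _
  (freq R [pred c : quot NM | [exists i : 'I_n,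
  `[< forall x, pf_proj NM x = c -> V i x >] ]])).
  apply: le_freq => c /= /asboolP cK'; apply/existsP.
  have [i si ci] := sP _ (cK' _ (quot_liftK c)).
  have i_n : (i < n)%N by rewrite ltnS leq_bigmax_seq.
  exists (Ordinal i_n); apply/asboolP => x; rewrite -(quot_liftK c) => /pf_projP cx.
  by apply: ci; apply: cyl_sub cx => z [].
exact: (freq_exists _ (fun (i : 'I_n) (c : quot NM) => `[< forall x,
  pf_proj NM x = c -> V i x >])).
Qed.

End Haar.

(** * Construction of the measure from the outer measure *)

Section HaarMeasure.
Variables (R : realType) (G : groupType).
Implicit Types (N M : fin_normal G) (x y : profinite G)
  (A U V K : set (profinite G)).

Local Notation omass := (@omass R G).

Definition haar_real A : R := inf [set omass U | U in [set U | open U /\ A `<=` U]].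

Lemma haar_has_inf A : has_inf [set omass U | U in [set U | open U /\ A `<=` U]].
Proof.
split; first by exists (omass setT); exists setT => //; split; [exact: openT|].
by exists 0 => _ [U _ <-]; exact: omass_ge0.
Qed.

Lemma haar_real_le A U : open U -> A `<=` U -> haar_real A <= omass U.
Proof. by move=> oU AU; apply: (ge_inf (haar_has_inf A).2); exists U. Qed.

Lemma haar_real_ge A r :
  (forall U, open U -> A `<=` U -> r <= omass U) -> r <= haar_real A.
Proof.
move=> H; apply: lb_le_inf; first exact: (haar_has_inf A).1.
by move=> _ [U [oU AU] <-]; exact: H.
Qed.

Lemma haar_real_adherent A (e : R) : 0 < e ->
  exists U, [/\ open U, A `<=` U & omass U < haar_real A + e].
Proof.
move=> e0; have [_ [U [oU AU] <-] lt] := inf_adherent e0 (haar_has_inf A).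
by exists U.
Qed.

Lemma haar_real_open U : open U -> haar_real U = omass U.
Proof.
move=> oU; apply/eqP; rewrite eq_le haar_real_le//=.
by apply: haar_real_ge => V _; exact: le_omass.
Qed.

Lemma haar_real_ge0 A : 0 <= haar_real A.
Proof. by apply: haar_real_ge => U _ _; exact: omass_ge0. Qed.

Definition haar_outer A : \bar R := (haar_real A)%:E.

Lemma haar_outer0 : haar_outer set0 = 0%E.
Proof. by rewrite /haar_outer haar_real_open ?omass_set0//; exact: open0. Qed.

Lemma haar_outer_ge0 A : (0 <= haar_outer A)%E.
Proof. by rewrite lee_fin haar_real_ge0. Qed.

Lemma le_haar_outer : {homo haar_outer : A B / A `<=` B >-> (A <= B)%E}.
Proof.
move=> A B AB; rewrite lee_fin; apply: haar_real_ge => U oU BU.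
by apply: haar_real_le => //; exact: subset_trans BU.
Qed.

Lemma haar_outer_sigma_subadditive : sigma_subadditive haar_outer.
Proof.
move=> F; apply/lee_addgt0Pr => e e0.
apply: (le_trans _ (epsilon_trick xpredT (fun n => haar_outer_ge0 (F n)) (ltW e0))).
have ch n : exists U,
  [/\ open U, F n `<=` U & omass U < haar_real (F n) + e / (2 ^ n.+1)%:R].
  by apply: haar_real_adherent; rewrite divr_gt0// ltr0n expn_gt0.
have {ch} [U UP] := choice ch.
have oU : open (\bigcup_n U n) by apply: bigcup_open => n _; have [] := UP n.
apply: (@le_trans _ _ (omass (\bigcup_n U n))%:E).
  rewrite lee_fin haar_real_le//; apply: subset_bigcup => n _.
  by have [] := UP n.
apply: le_trans (@omass_subadd R G _ U oU _ _) _ => //; first by move=> n;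
  have [] := UP n.
apply: lee_nneseries => [n _ _|n _]; first by rewrite lee_fin omass_ge0.
by rewrite -EFinD lee_fin ltW//; have [] := UP n.
Qed.

HB.instance Definition _ := isOuterMeasure.Build R (profinite G) haar_outer
  haar_outer0 haar_outer_ge0 le_haar_outer haar_outer_sigma_subadditive.

(* The part of [U] inside [V] is exhausted by clopen sets [core N (U `&` V)],
   and [mass_add] is exact for these. *)
Lemma haar_caratheodory_open V : open V -> haar_outer.-caratheodory V.
Proof.
move=> oV; apply: le_caratheodory_measurable => A.
rewrite -EFinD lee_fin; apply: haar_real_ge => U oU AU.
have H N : mass R N (U `&` V) + haar_real (U `\` V) <= omass U.
  have satN := @core_saturated _ N (U `&` V).
  have sub : core N (U `&` V) `<=` U by move=> x /core_sub [].
  have oUK : open (U `\` core N (U `&` V)).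
    rewrite setDE; apply: openI => //.
    exact: (cyl_saturated_open (saturatedC satN)).
  apply: (@le_trans _ _ (mass R N (U `&` V) + omass (U `\` core N (U `&` V)))).
    rewrite lerD2l; apply: haar_real_le => //.
    by move=> x [Ux nVx]; split=> // /core_sub[].
  rewrite addrC -lerBrDr; apply: omass_le => M; rewrite lerBrDr.
  have NMN : fnI N M `<=` N by move=> z [].
  have NMM : fnI N M `<=` M by move=> z [].
  apply: (@le_trans _ _ (mass R (fnI N M) U)); last exact: mass_le_omass.
  rewrite (mass_add R (saturated_sub NMN satN) sub) addrC lerD//.
    by rewrite (mass_refine R NMN satN) mass_core.
  exact: le_mass_refine.
have : omass (U `&` V) + haar_real (U `\` V) <= omass U.
  by rewrite -lerBrDr; apply: omass_le => N; rewrite lerBrDr.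
apply: le_trans; apply: lerD.
  apply: haar_real_le; first exact: openI.
  exact: setSI.
by rewrite -lee_fin; apply: le_haar_outer; rewrite setDE; exact: setSI.
Qed.

Lemma haar_caratheodory_borel (A : set (borelType (profinite G))) :
  measurable A -> haar_outer.-caratheodory A.
Proof.
suff H : <<s @open (profinite G) >> `<=` haar_outer.-caratheodory by move/H.
apply: smallest_sub; last exact: haar_caratheodory_open.
split=> [|B cB|F cF].
- exact: caratheodory_measurable_set0.
- by rewrite setTD; exact: caratheodory_measurable_setC.
- exact: caratheodory_measurable_bigcup.
Qed.

Definition haar (A : set (borelType (profinite G))) : \bar R := haar_outer A.

Lemma haar_sigma_additive : semi_sigma_additive haar.
Proof.
move=> F mF tF mUF.
apply: (@caratheodory_measure_sigma_additive R (profinite G) haar_outer F) => //.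
  by move=> i; exact: haar_caratheodory_borel.
exact: haar_caratheodory_borel.
Qed.

HB.instance Definition _ := isMeasure.Build _ (borelType (profinite G)) R haar
  haar_outer0 haar_outer_ge0 haar_sigma_additive.

Lemma haar_setT : haar setT = 1%E.
Proof. by rewrite /haar /haar_outer haar_real_open ?omass_setT//; exact: openT. Qed.

HB.instance Definition _ :=
  Measure_isProbability.Build _ (borelType (profinite G)) R haar
  haar_setT.

Lemma mass_translate N x U : mass R N [set (x * y)%g | y in U] = mass R N U.
Proof.
have inj : injective (@quot_act _ N x^-1%g) by exact:
  (@gaction_inj _ _ _ (@quot_act_action _ N)).
rewrite /mass -[RHS](freq_inj _ _ inj); apply: eq_freq => c /=.
apply/asboolP/asboolP => H y yc.
  have [|z Uz xz] := H (x * y)%g.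
    by rewrite pf_projM yc (gactionKV (@quot_act_action _ N)).
  by move: xz => /mulgI <-.
exists (x^-1 * y)%g; last by rewrite mulVKg.
by apply: H; rewrite pf_projM yc.
Qed.

Lemma haar_translate_le x A : haar_real [set (x * y)%g | y in A] <= haar_real A.
Proof.
apply: haar_real_ge => U oU AU.
have -> : omass U = omass [set (x * y)%g | y in U].
  by congr sup; apply/seteqP; split=> _ [N _ <-]; exists N => //;
    rewrite mass_translate.
apply: haar_real_le; first exact: profinite_mul_open.
by move=> _ [y Ay <-]; exists y => //; exact: AU.
Qed.

Lemma haar_is_haar : is_haar (haar : probability (borelType (profinite G)) R).
Proof.
split=> [x A mA|A mA].
  congr EFin; apply/eqP; rewrite eq_le haar_translate_le/=.
  have := haar_translate_le x^-1%g [set (x * y)%g | y in A].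
  congr (haar_real _ <= _); apply/seteqP; split=> [_ [_ [y Ay <-] <-]|y Ay].
    by rewrite mulKg.
  by exists (x * y)%g; [exists y|rewrite mulKg].
apply/eqP; rewrite eq_le; apply/andP; split; last first.
  by apply: ge_ereal_sup => _ [K [_ KA] <-]; exact: le_haar_outer.
apply/lee_addgt0Pr => e e0.
(* Inner regularity at [A] is outer regularity at its complement, as complements of open sets are
   compact here. *)
have [U [oU AU Ue]] := haar_real_adherent (~` A) e0.
have mU : measurable (U : set (borelType (profinite G))) by exact:
  sub_sigma_algebra.
apply: (@le_trans _ _ (haar (~` U) + e%:E)%E); last first.
  rewrite leeD2r//; apply: ereal_sup_ubound; exists (~` U) => //; split.
    by apply: profinite_closed_compact; exact: open_closedC.
  by rewrite -[X in _ `<=` X]setCK; exact: subsetC.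
have eU := probability_setC (haar : probability (borelType (profinite G)) R) mU.
have eA := probability_setC (haar : probability (borelType (profinite G)) R) mA.
move: eU eA; rewrite /= /haar /haar_outer => [[->]] [].
rewrite (haar_real_open oU) => eA; rewrite -EFinD lee_fin.
move: Ue; rewrite eA; lra.
Qed.

End HaarMeasure.

(** * Weak containment through labellings *)

Section WeakLabels.
Variables (R : realType) (G : groupType).

Lemma mp_action_gaction d (X : measurableType d) (mu : probability X R)
  (a : G -> X -> X) : mp_action mu a -> is_gaction a.
Proof. by move=> [a1 aM _ _]; split. Qed.

(** Invariance under [g^-1] replaces the part of [B] covered by the translate of [A] by the set of
    points that [g] takes from [A] to [B], the form suited to labellings. *)
Lemma mp_image d (X : measurableType d) (mu : probability X R) (a : G -> X -> X)
    g (A B : set X) : mp_action mu a -> measurable A -> measurable B ->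
  mu (a g @` A `&` B) = mu [set x | A x /\ B (a g x)].
Proof.
move=> mpa mA mB; have aact := mp_action_gaction mpa.
case: mpa => a1 aM am ainv.
rewrite -(ainv g^-1%g [set x | A x /\ B (a g x)]); last first.
  apply: (measurableI A (a g @^-1` B)) => //.
  by rewrite -[X in measurable X]setTI; exact: am.
congr (mu _); apply/seteqP; split=> [y [[x Ax <-] By]|y [/= Ay]].
  by rewrite /= (gactionK aact).
by rewrite (gactionKV aact) => By; split=> //; exists (a g^-1%g y) => //;
  rewrite (gactionKV aact).
Qed.

Definition weak_labels d (X : measurableType d) (mu : probability X R)
    (a : G -> X -> X) d' (Y : measurableType d') (nu : probability Y R)
    (b : G -> Y -> Y) : Prop :=
  forall (k : nat) (l : X -> 'I_k), labelling l -> forall (F : seq G) (e : R),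
    0 < e ->
  exists2 m : Y -> 'I_k, labelling m & forall g, g \in F -> forall i j,
    `|pr mu [set x | l x = i /\ l (a g x) = j] -
      pr nu [set y | m y = i /\ m (b g y) = j]| < e.

Lemma partition_labelling d (X : measurableType d) k (A : 'I_k -> set X) :
  measurable_partition A -> exists2 l : X -> 'I_k, labelling l &
    forall i, A i = l @^-1` [set i].
Proof.
move=> [mA tA cA].
have [l lP] : {l : X -> 'I_k & forall x, A (l x) x}.
  apply: (@choice _ _ (fun x i => A i x)) => x; have : [set: X] x by [];
    rewrite -cA => -[i _ Aix]; by exists i.
have lE i : A i = l @^-1` [set i].
  apply/seteqP; split=> [x Aix|x /= <- //].
  apply: contrapT => /eqP ne; have /trivIsetP /(_ (l x) i Logic.I Logic.I ne) := tA.
  by rewrite -subset0 => /(_ x); apply; split.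
by exists l => // i; rewrite -lE.
Qed.

Lemma labelling_partition d (X : measurableType d) k (l : X -> 'I_k) :
  labelling l -> measurable_partition (fun i => l @^-1` [set i]).
Proof.
move=> ml; split=> //; last by apply/seteqP; split=> // x _; exists (l x).
by apply/trivIsetP => i j _ _ ij; rewrite -subset0 => x [/= -> ji];
  rewrite ji eqxx in ij.
Qed.

Lemma weak_labelsP d (X : measurableType d) (mu : probability X R)
    (a : G -> X -> X) d' (Y : measurableType d') (nu : probability Y R)
    (b : G -> Y -> Y) : mp_action mu a -> mp_action nu b ->
  weakly_contained mu a nu b <-> weak_labels mu a nu b.
Proof.
move=> mpa mpb; split=> [wc k l ml F e e0|wl k A pA F finF e e0].
  have [B [pB BP]] := wc _ _ (labelling_partition ml) _ (finite_seq F) _ e0.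
  have [m mm mE] := partition_labelling pB.
  exists m => // g gF i j; have := BP g gF i j.
  by rewrite !mE (mp_image _ mpa)// (mp_image _ mpb).
have [l ml lE] := partition_labelling pA.
have /finite_seqP[s sE] := finF.
have [m mm mP] := wl _ _ ml s _ e0.
exists (fun i => m @^-1` [set i]); split; first exact: labelling_partition.
move=> g; rewrite sE => gs i j.
rewrite !lE (mp_image _ mpa)// (mp_image _ mpb)//; exact: mP.
Qed.

End WeakLabels.

(** * Translation action on the profinite completion *)

Section ProfiniteAction.
Variables (R : realType) (G : groupType).
Variable mu : probability (borelType (profinite G)) R.
Hypothesis haar_mu : is_haar mu.

Lemma profinite_actionE (g : G) (x : profinite G) : profinite_action g x =
  (profinite_eta g * x)%g.
Proof. by []. Qed.

Lemma translate_preimage (x : profinite G) (A : set (profinite G)) :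
  [set y | A (x * y)%g] = [set (x^-1 * y)%g | y in A].
Proof.
apply/seteqP; split=> [y Axy|_ [y Ay <-]] /=; last by rewrite mulVKg.
by exists (x * y)%g => //; rewrite mulKg.
Qed.

Lemma profinite_action_measurable (g : G) :
  measurable_fun [set: borelType (profinite G)] (profinite_action g).
Proof.
apply: (@measurability _ _ _ (borelType (profinite G)) _ _
  (@open (profinite G))) => // _ [U oU <-].
rewrite setTI; apply: sub_sigma_algebra.
by have := translate_preimage (profinite_eta g) U; rewrite /preimage => ->;
  exact: profinite_mul_open.
Qed.

Lemma profinite_mp_action : mp_action mu (@profinite_action G).
Proof.
split=> [x|g h x|g|g A mA].
- by rewrite profinite_actionE mul1g.
- by rewrite !profinite_actionE profinite_etaM mulgA.
- exact: profinite_action_measurable.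
- by rewrite -(haar_mu.1 (profinite_eta g)^-1%g A mA) -translate_preimage.
Qed.

Lemma pf_proj_labelling (N : fin_normal G) :
  labelling (@pf_proj G N : borelType (profinite G) -> quot N).
Proof.
move=> c; apply: sub_sigma_algebra; apply: (@cyl_saturated_open _ N).
by move=> x y xy /= <-; apply/pf_projP.
Qed.

(** The cylinders of [N] are translates of one another, so each has measure [1 / #|quot N|]. *)
Lemma haar_freq (N : fin_normal G) (P : pred (quot N)) :
  pr mu [set x | P (pf_proj N x)] = freq R P.
Proof.
have lab := @pf_proj_labelling N.
have fiber c c' : pr mu (@pf_proj G N @^-1` [set c]) =
  pr mu (@pf_proj G N @^-1` [set c']).
  have [x xc] := @quot_act_transitive _ N c c'.
  rewrite /pr -(haar_mu.1 x _ (lab c)); congr (fine (mu _)).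
  apply/seteqP; split=> [_ [y /= yc <-]|y /= yc'].
    by rewrite /= pf_projM yc xc.
  exists (x^-1 * y)%g; last by rewrite mulVKg.
  by rewrite /= pf_projM yc' -xc (gactionK (@quot_act_action _ N)).
pose c0 := pf_proj N 1%g; pose p := pr mu (@pf_proj G N @^-1` [set c0]).
have sumE (Q : pred (quot N)) : pr mu [set x | Q (pf_proj N x)] = #|Q|%:R * p.
  rewrite (pr_sum mu Q lab) (eq_bigr (fun=> p)) => [|c _]; last exact: fiber.
  by rewrite sumr_const mulr_natl.
have card0 : #|quot N|%:R != 0 :> R by rewrite pnatr_eq0 -lt0n quot_gt0.
have tot : #|quot N|%:R * p = 1.
  rewrite -(sumE predT) -(pr_setT mu); congr pr; exact/seteqP.
have pE : p = #|quot N|%:R^-1 by apply: (mulfI card0); rewrite tot divff.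
by rewrite sumE /freq pE.
Qed.

End ProfiniteAction.

(** * Transitive finite sets as factors of the profinite completion *)

Section TransitiveFactor.
Variables (R : realType) (G : groupType) (T : finType) (a : G -> T -> T).
Hypotheses (aact : is_gaction a) (atr : gtransitive a) (t0 : T).

Definition act_kernel : fin_normal G.
Proof.
apply: (@FinNormal _ [set g | forall t, a g t = t]).
- exact: aact.1.
- by move=> x y /= ax ay t; rewrite aact.2 ay ax.
- by move=> x /= ax t; rewrite -{1}(ax t) (gactionK aact).
- by move=> x y /= ax t; rewrite /conjg !aact.2 ax (gactionK aact).
(* A coset of the kernel is determined by the map of [T] that its elements induce, and there are
   finitely many such maps. *)
- apply: (@sub_finite_set _ _
  [set [set g | forall t, a g t = f t] | f in [set: {ffun T -> T}]]).
    move=> _ [g _ <-]; exists [ffun t => a g t] => //.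
    apply/seteqP; split=> [h /= hg|_ [n /= an <-] t].
      exists (g^-1 * h)%g; last by rewrite mulVKg.
      by move=> t; rewrite aact.2 hg ffunE (gactionK aact).
    by rewrite aact.2 an ffunE.
  exact/finite_image/finite_finset.
Defined.

(** The orbit map of [t0], sending the coset of [g] to [a g t0]. *)
Definition trans_factor (c : quot act_kernel) : T :=
  a (sval (cid (pf_coset (quot_lift c) act_kernel))) t0.

Lemma trans_factorE (x : profinite G) g : pf_val x act_kernel =
  coset_left g act_kernel ->
  trans_factor (pf_proj act_kernel x) = a g t0.
Proof.
move=> xg; rewrite /trans_factor; case: cid => h /= hE.
have : coset_left g act_kernel = coset_left h act_kernel.
  by rewrite -xg -hE; have /pf_projP -> := quot_liftK (pf_proj act_kernel x).
by move=> /coset_left_eq gh; rewrite -[in RHS](gh t0) -aact.2 mulVKg.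
Qed.

Lemma trans_factor_eta g c :
  trans_factor (quot_act (profinite_eta g) c) = a g (trans_factor c).
Proof.
rewrite -(quot_liftK c) -pf_projM; have [h hE] := pf_coset (quot_lift c) act_kernel.
by rewrite (trans_factorE hE) -aact.2; apply: trans_factorE; exact: pf_mulE.
Qed.

Definition trans_map (x : borelType (profinite G)) : T :=
  trans_factor (pf_proj act_kernel x).

Lemma trans_map_labelling : labelling trans_map.
Proof. exact: (labelling_comp trans_factor (@pf_proj_labelling G act_kernel)). Qed.

Lemma trans_map_equivariant g x : trans_map (profinite_action g x) =
  a g (trans_map x).
Proof. by rewrite /trans_map profinite_actionE pf_projM trans_factor_eta. Qed.

Lemma trans_map_freq (mu : probability (borelType (profinite G)) R) (P : pred T) :
  is_haar mu -> pr mu [set x | P (trans_map x)] = freq R P.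
Proof.
move=> hmu; rewrite (haar_freq hmu [pred c | P (trans_factor c)]).
apply: (freq_equivariant R P (a := fun g => quot_act (profinite_eta g)) (b :=
  a)) => //.
- exact: quot_eta_action.
- exact: quot_gt0.
- exact: trans_factor_eta.
Qed.

End TransitiveFactor.

(** Half of [e] pays for the finite model, the other half for making it transitive. The transitive
    model is a factor of the completion, along which its labels are pulled back. *)
Lemma weak_labels_profinite (R : realType) (G1 G2 : groupType)
    (mu : probability (borelType (profinite (free_product G1 G2))) R)
    (Q1 Q2 : finType) (c1 : G1 -> Q1 -> Q1) (c2 : G2 -> Q2 -> Q2)
    d (X : measurableType d) (nu : probability X R) (b : free_product G1 G2 ->
      X -> X) :
  is_haar mu -> is_gaction c1 -> is_gaction c2 -> gtransitive c1 ->
    gtransitive c2 ->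
  (1 < #|Q1|)%N -> (1 < #|Q2|)%N -> fin_approx nu b ->
  weak_labels nu b mu (@profinite_action (free_product G1 G2)).
Proof.
move=> hmu c1act c2act c1tr c2tr Q12 Q22 ab k l ml F e e0.
have e20 : 0 < e / 2 by rewrite divr_gt0.
have [T [a [m [T0 aact am]]]] := ab _ _ ml F _ e20.
have a1act := gaction_comp (@fp_inlM G1 G2) aact.
have a2act := gaction_comp (@fp_inrM G1 G2) aact.
have [W [aW [mW [KW aWact aWtr aWm]]]] :=
  transitivize m F 0 a1act a2act c1act c2act c1tr c2tr Q12 Q22 T0 e20.
have /fintype.card_gt0P[w0 _] := KW.
exists (mW \o trans_map aWact w0); first by apply: labelling_comp;
  exact: trans_map_labelling.
move=> g gF i j; have := am g gF i j; have := aWm g gF i j.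
have -> : [set y | (mW \o trans_map aWact w0) y = i /\
    (mW \o trans_map aWact w0) (profinite_action g y) = j] =
    [set y | [pred w | (mW w == i) && (mW (aW g w) == j)] (trans_map aWact w0 y)].
  apply/seteqP; split=> y /=; rewrite trans_map_equivariant.
    by move=> [-> ->]; rewrite !eqxx.
  by move=> /andP[/eqP -> /eqP ->].
rewrite trans_map_freq//.
have -> : freq R [pred t | (m t == i) &&
  (m (fp_act (a \o @fp_inl G1 G2) (a \o @fp_inr G1 G2) g t) == j)]
   = freq R [pred t | (m t == i) && (m (a g t) == j)].
  by apply: eq_freq => t /=; rewrite -{2}(fp_reprK g) fp_act_unique.
move=> H1 H2; rewrite [X in _ < X](splitr e).
exact: le_lt_trans (ler_distD _ _ _) (ltrD H2 H1).
Qed.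

(** * Finite approximability of actions of finite and of MD groups *)

Lemma freq_weighted (R : realType) (T Q I : finType) (f : T -> I) (P : I ->
  pred Q) :
  freq R [pred p : T * Q | P (f p.1) p.2] =
  \sum_i freq R [pred t | f t == i] * freq R (P i).
Proof.
have -> : freq R [pred p : T * Q | P (f p.1) p.2] =
    (\sum_i #|[pred t | f t == i]| * #|P i|)%N%:R / (#|T| * #|Q|)%:R.
  rewrite /freq card_prod; congr (_%:R / _).
  rewrite -sum1_card (partition_big (fun p => f p.1) predT)//=.
  apply: eq_bigr => i _; rewrite -cardX -sum1_card; apply: eq_bigl => -[t q].
  by rewrite !inE /= andbC; case: eqP => // ->.
rewrite natr_sum mulr_suml; apply: eq_bigr => i _.
by rewrite /freq !natrM mulf_div.
Qed.

Lemma sum_cst_lt (R : realType) (I : finType) (e : R) : 0 < e ->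
  \sum_(i : I) e / (#|I|%:R + 1) < e.
Proof.
move=> e0; rewrite sumr_const -[ltLHS]mulr_natl mulrA ltr_pdivrMr ?ltr_wpDl//.
by rewrite mulrDr mulr1 mulrC ltrDl.
Qed.

(** Rounding turns the weights into multiplicities: the model consists of [n] copies of [Q], the
    copy of index [k] being labelled by [L (f k)]. *)
Lemma weighted_model (R : realType) (G : groupType) (Q I S : finType)
    (c : G -> Q -> Q) (w : I -> R) (L : I -> Q -> S) (e : R) :
  is_gaction c -> (0 < #|Q|)%N -> (forall i, 0 <= w i) -> \sum_i w i = 1 -> 0 < e ->
  exists (T : finType) (a : G -> T -> T) (m : T -> S),
    [/\ (0 < #|T|)%N, is_gaction a & forall g s s',
      `|\sum_i w i * freq R [pred q | (L i q == s) && (L i (c g q) == s')] -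
        freq R [pred t | (m t == s) && (m (a g t) == s')]| < e].
Proof.
move=> cact Q0 w0 w1 e0.
pose dl := e / (#|I|%:R + 1).
have dl0 : 0 < dl by rewrite divr_gt0// ltr_wpDl.
have [n [f [n0 fP]]] := rounding w0 w1 dl0.
exists ('I_n * Q)%type, (fun g p => (p.1, c g p.2)), (fun p => L (f p.1) p.2).
split=> [||g s s'].
- by rewrite card_prod card_ord muln_gt0 n0.
- by split=> [[i q]|g h [i q]] /=; rewrite ?cact.1 ?cact.2.
rewrite (@freq_weighted R _ _ _ f
  (fun i => [pred q | (L i q == s) && (L i (c g q) == s')])).
rewrite -sumrB; apply: le_lt_trans (ler_norm_sum _ _ _) _.
apply: (@le_lt_trans _ _ (\sum_(i : I) dl)).
  apply: ler_sum => i _; rewrite -mulrBl normrM.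
  have := fP i; rewrite distrC => /ltW H; rewrite -[leRHS]mulr1.
  apply: ler_pM => //; rewrite ger0_norm ?freq_ge0//.
  by rewrite -(freq_predT R Q0); exact: le_freq.
exact: sum_cst_lt.
Qed.

Lemma freqE (R : realType) (T : finType) (P : pred T) :
  freq R P = \sum_t (P t)%:R / #|T|%:R.
Proof.
rewrite -mulr_suml /freq -natr_sum -sum1_card big_mkcond; congr (_%:R / _).
Qed.

Section FiniteGroup.
Variables (R : realType) (G : groupType).

Lemma fin_normal1 : finite_set [set: G] ->
  exists N : fin_normal G, forall g, fn_set N g -> g = 1%g.
Proof.
move=> Gfin.
have H1 : [set 1%g : G] 1%g by [].
have HM x y : [set 1%g : G] x -> [set 1%g : G] y -> [set 1%g : G] (x * y)%g.
  by move=> -> ->; rewrite /= mulg1.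
have HV x : [set 1%g : G] x -> [set 1%g : G] x^-1%g by move=> ->; rewrite /= invg1.
have HJ x y : [set 1%g : G] x -> [set 1%g : G] (x ^ y)%g.
  by move=> ->; rewrite /= /conjg mul1g mulVg.
have HF : finite_set [set coset_left x [set 1%g : G] | x in [set: G]] by exact:
  finite_image.
by exists (FinNormal H1 HM HV HJ HF).
Qed.

(** Each orbit map pulls the labelling back to the group, acting on itself by translation. The
    distribution of these labelled groups over the space gives the weights of the model. *)
Lemma finite_fin_approx d (X : measurableType d) (nu : probability X R)
    (b : G -> X -> X) : finite_set [set: G] -> mp_action nu b -> fin_approx nu b.
Proof.
move=> /fin_normal1 [N N1] mpb S l ml F e e0.
have bact := mp_action_gaction mpb.
pose Q := quot N; pose c (g : G) (q : Q) : Q := quot_act (profinite_eta g) q.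
have cact : is_gaction c := quot_eta_action N.
have [rep repK] := choice (@pf_proj_eta_surj G N).
have inj g h : pf_proj N (profinite_eta g) = pf_proj N (profinite_eta h) -> g = h.
  move=> /pf_projP /coset_left_eq /N1 H.
  by apply: (@mulgI _ g^-1%g); rewrite H mulVg.
have repM g q : rep (c g q) = (g * rep q)%g.
  by apply: inj; rewrite repK profinite_etaM pf_projM repK.
pose I : finType := {ffun Q -> S}.
pose lw (x : X) : I := [ffun q => l (b (rep q) x)].
have bm g : measurable_fun setT (b g) by have [_ _ + _] := mpb; apply.
have mlw : labelling lw.
  by apply: labelling_ffun => q; apply: labelling_act => //; exact: bm.
pose w (i : I) := pr nu (lw @^-1` [set i]).
have w1 : \sum_i w i = 1.
  rewrite -(pr_sum nu predT mlw) -(pr_setT nu); congr pr; exact/seteqP.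
have [T [a [m [T0 aact am]]]] :=
  weighted_model (fun (i : {ffun Q -> S}) q => i q) cact (quot_gt0 N)
  (fun i => pr_ge0 nu _) w1 e0.
exists T, a, m; split=> // g gF s s'.
suff -> : pr nu [set x | l x = s /\ l (b g x) = s'] =
  \sum_i w i * freq R [pred q | (i q == s) && (i (c g q) == s')] by [].
pose P0 := pr nu [set x | l x = s /\ l (b g x) = s'].
(* By invariance of the measure under [rep q], every point [q] of the group contributes the same
   share of [P0]. *)
transitivity (\sum_(q : Q) P0 / #|Q|%:R).
  by rewrite sumr_const -[RHS]mulr_natl mulrCA mulfV ?mulr1// pnatr_eq0 -lt0n
    quot_gt0.
under [RHS]eq_bigr do rewrite freqE mulr_sumr.
rewrite exchange_big; apply: eq_bigr => q _ /=.
under [RHS]eq_bigr do rewrite mulrA.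
rewrite -mulr_suml; congr (_ / _).
pose C := [pred i : I | (i q == s) && (i (c g q) == s')].
transitivity (\sum_(i | C i) w i); last first.
  rewrite big_mkcond; apply: eq_bigr => i _ /=.
  by case: ifP => _; rewrite ?mulr1 ?mulr0.
rewrite -(pr_sum nu C mlw) /P0 /pr; have [_ _ _ binv] := mpb.
rewrite -(binv (rep q)).
  congr (fine (nu _)); apply/seteqP; split=> x /=; rewrite !ffunE repM bact.2.
    by move=> [-> ->]; rewrite !eqxx.
  by move=> /andP[/eqP -> /eqP ->].
exact: (measurableI _ _ (ml s) (labelling_act (bm g) ml s')).
Qed.

End FiniteGroup.

(** * Approximation of measurable sets and labellings by cylinders *)

Definition symd (T : Type) (A B : set T) : set T := (A `\` B) `|` (B `\` A).

Lemma symdP (T : Type) (A B : set T) x : ~ symd A B x -> A x <-> B x.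
Proof.
by move=> nAB; split=> H; apply: contrapT => H'; apply: nAB; [left|right].
Qed.

Lemma measurable_symd d (T : measurableType d) (A B : set T) :
  measurable A -> measurable B -> measurable (symd A B).
Proof. by move=> mA mB; apply: measurableU; exact: measurableD. Qed.

Section CylinderApproximation.
Variables (R : realType) (G : groupType).
Variable mu : probability (borelType (profinite G)) R.
Hypothesis haar_mu : is_haar mu.

Lemma measurable_proj (N : fin_normal G) (P : pred (quot N)) :
  measurable ([set x | P (pf_proj N x)] : set (borelType (profinite G))).
Proof. exact: (labelling_measurable P (@pf_proj_labelling G N)). Qed.

Lemma haar_inner (B : set (borelType (profinite G))) (e : R) : measurable B ->
  0 < e ->
  exists K : set (profinite G),
    [/\ compact K, K `<=` B, measurable (K : set (borelType (profinite G)))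
    & pr mu (B `\` K) < e].
Proof.
move=> mB e0; have := haar_mu.2 B mB.
have fB : mu B \is a fin_num by rewrite fin_num_measure.
move=> BE; rewrite BE in fB.
have [_ [K [cK KB] <-]] := ub_ereal_sup_adherent e0 fB.
rewrite -BE => lt.
have mK : measurable (K : set (borelType (profinite G))).
  rewrite -[K]setCK; apply: measurableC; apply: sub_sigma_algebra.
  by apply: closed_openC; exact: compact_closed (@profinite_hausdorff G) cK.
exists K; split=> //.
have : pr mu B = pr mu K + pr mu (B `\` K).
  rewrite -prU; [by congr pr; rewrite setDUK|by []|exact: measurableD|].
  by rewrite setDE setICA setICr setI0.
by move: lt; rewrite (pr_fin mu mB) (pr_fin mu mK) -EFinB lte_fin; lra.
Qed.

(** Exhaust [B] and its complement, up to [e / 2] each, by compact sets [K] and [K']. For small [N]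
    the cylinders around points of [K] avoid [K'], so their union errs only outside both compact
    sets. *)
Lemma haar_cyl_approx (B : set (borelType (profinite G))) (e : R) :
  measurable B -> 0 < e -> exists (N : fin_normal G) (P : pred (quot N)),
    pr mu (symd B [set x | P (pf_proj N x)]) < e.
Proof.
move=> mB e0; have e20 : 0 < e / 2 by rewrite divr_gt0.
have [K [cK KB mK Ke]] := haar_inner mB e20.
have [K' [cK' KB' mK' Ke']] := haar_inner (measurableC mB) e20.
(* The cover passed to [cyl_uniform] has a single member, the complement of [K']. *)
have oU (i : unit) : open (~` K' : set (profinite G)).
  by apply: closed_openC; exact: compact_closed (@profinite_hausdorff G) cK'.
have KU : K `<=` \bigcup_(i : unit) (~` K').
  by move=> x /KB Bx; exists tt => // /KB'.
have [N [s NP]] := cyl_uniform tt cK oU KU.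
exists N, [pred c | `[< exists2 x, K x & pf_proj N x = c >]].
apply: (@le_lt_trans _ _ (pr mu ((B `\` K) `|` (~` B `\` K')))).
  apply: le_pr.
  - apply: measurable_symd => //; exact: measurable_proj.
  - by apply: measurableU; apply: measurableD => //; exact: measurableC.
  move=> x [[Bx /= nP]|[/= /asboolP[y Ky /pf_projP yx] nBx]].
    by left; split=> // Kx; apply: nP; apply/asboolP; exists x.
  right; split=> // K'x; have [_ _ sub] := NP _ Ky.
  by apply: (sub x) K'x; exact: cyl_sym.
apply: le_lt_trans (le_prU _ _ _) _; first exact: measurableD.
  by apply: measurableD => //; exact: measurableC.
lra.
Qed.

End CylinderApproximation.

Section ProductApproximation.
Variables (R : realType) (G : groupType).
Variable mu : probability (borelType (profinite G)) R.
Hypothesis haar_mu : is_haar mu.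
Let U := uniform_prob (@ltr01 R).
Let Z : measurableType _ := (measurableTypeR R * borelType (profinite G))%type.
Let P : probability Z R := (U \x mu)%E.

Lemma iota_mp_action : mp_action P (@iota_profinite_action R G).
Proof.
have [a1 aM am ainv] := profinite_mp_action haar_mu.
split=> [[t x]|g h [t x]|g|g A mA].
- by rewrite /iota_profinite_action /= a1.
- by rewrite /iota_profinite_action /= aM.
- apply: measurable_fun_pair; first exact: measurable_fst.
  by apply: measurableT_comp (am g) _; exact: measurable_snd.
- apply: eq_integral => t _ /=.
  rewrite -(ainv g (xsection A t)); last exact: measurable_xsection.
  congr (mu _); apply/seteqP; split=> x /=; rewrite /xsection /= !inE //.
Qed.

Lemma pr_rectangle (A : set (measurableTypeR R))
  (B : set (borelType (profinite G))) :
  measurable A -> measurable B -> pr P (A `*` B) = pr U A * pr mu B.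
Proof.
move=> mA mB; apply: EFin_inj; rewrite EFinM -!pr_fin//; last exact: measurableX.
exact: product_measure1E.
Qed.

(* Finite unions of rectangles whose second side is a coset cylinder, brought to
   a common [N]. *)
Definition simple_set (E : set Z) : Prop :=
  exists (N : fin_normal G) (D : quot N -> set (measurableTypeR R)),
    (forall c, measurable (D c)) /\ E = [set z | D (pf_proj N z.2) z.1].

Lemma simple_set_measurable E : simple_set E -> measurable E.
Proof.
move=> [N [D [mD ->]]].
rewrite (_ : [set _ | _] = \bigcup_(c in [set: quot N])
  (D c `*` (@pf_proj G N @^-1` [set c]))).
  apply: fin_bigcup_measurable => // c _; apply: measurableX => //.
  exact: (@pf_proj_labelling G N).
apply/seteqP; split=> [[t x] /= Dx|[t x] [c _ [/= Dc xc]]];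
  first by exists (pf_proj N x).
by rewrite xc.
Qed.

(** These sets will be shown to form a sigma-algebra containing the measurable rectangles. *)
Definition approximable (E : set Z) : Prop := measurable E /\
  forall e : R, 0 < e -> exists2 E', simple_set E' & pr P (symd E E') < e.

Lemma approximableC E : approximable E -> approximable (~` E).
Proof.
move=> [mE aE]; split=> [|e e0]; first exact: measurableC.
have [_ [N [D [mD ->]]] lt] := aE _ e0.
exists (~` [set z | D (pf_proj N z.2) z.1]).
  by exists N, (fun c => ~` D c); split=> // c; exact: measurableC.
by rewrite /symd !setDE !setCK setUC (setIC (~` _)) (setIC _ E).
Qed.

Lemma approximableU E F : approximable E -> approximable F ->
  approximable (E `|` F).
Proof.
move=> [mE aE] [mF aF]; split=> [|e e0]; first exact: measurableU.
have e20 : 0 < e / 2 by rewrite divr_gt0.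
have [E' sE' ltE] := aE _ e20; have [F' sF' ltF] := aF _ e20.
have mE' := simple_set_measurable sE'; have mF' := simple_set_measurable sF'.
exists (E' `|` F').
  have [N [D [mD ->]]] := sE'; have [N' [D' [mD' ->]]] := sF'.
  exists (fnI N N'), (fun c => D (quot_map N c) `|` D' (quot_map N' c)).
  split=> [c|]; first exact: measurableU.
  by apply/seteqP; split=> -[t x] /=; rewrite !quot_mapE// => z [].
apply: (@le_lt_trans _ _ (pr P (symd E E' `|` symd F F'))).
  apply: le_pr; first by apply: measurable_symd; exact: measurableU.
    by apply: measurableU; exact: measurable_symd.
  by move=> z; rewrite /symd;
    move=> [[[Ez|Fz] /not_orP[? ?]]|[[Ez|Fz] /not_orP[? ?]]];
    [left; left|right; left|left; right|right; right].
apply: le_lt_trans (le_prU _ _ _) _;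
  [exact: measurable_symd|exact: measurable_symd|lra].
Qed.

Lemma approximable0 : approximable set0.
Proof.
split=> // e e0; exists set0.
  by exists (fnT G), (fun=> set0); split.
by rewrite /symd setDv setU0 pr_set0.
Qed.

(** By continuity from below some finite partial union misses less than [e / 2] of the whole
    union. *)
Lemma approximable_bigcup (F : (set Z)^nat) :
  (forall n, approximable (F n)) -> approximable (\bigcup_n F n).
Proof.
move=> aF; have mF n : measurable (F n) by have [] := aF n.
split=> [|e e0]; first exact: bigcupT_measurable.
have e20 : 0 < e / 2 by rewrite divr_gt0.
pose H n := \big[setU/set0]_(i < n.+1) F i.
have aH n : approximable (H n).
  rewrite /H; elim/big_ind: _ => //; first exact: approximable0.
  by move=> *; exact: approximableU.
have mH n : measurable (H n) by have [] := aH n.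
have HF : \bigcup_n H n = \bigcup_n F n by exact: bigcup_bigsetU_bigcup.
have mFF : measurable (\bigcup_n F n) by exact: bigcupT_measurable.
have ndH : nondecreasing_seq H by move=> m n mn; apply/subsetPset;
  apply: subset_bigsetU; rewrite ltnS.
have cvgH : P \o H @ \oo --> P (\bigcup_n H n).
  by apply: nondecreasing_cvg_mu => //; rewrite HF.
have [n nP] : exists n, pr P (\bigcup_n F n) - e / 2 < pr P (H n).
  have : ((pr P (\bigcup_n F n) - e / 2)%:E < P (\bigcup_n H n))%E.
    by rewrite HF (pr_fin P mFF) lte_fin ltrBlDr ltrDl.
  move=> /open_ereal_gt' /cvgH [n _ Hn].
  by exists n; rewrite -lte_fin -pr_fin//; exact: (Hn n (leqnn n)).
have [E' sE' ltE] := (aH n).2 _ e20.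
have mE' := simple_set_measurable sE'.
exists E' => //.
have HnF : H n `<=` \bigcup_n F n by rewrite -HF; exact: bigcup_sup.
have -> : e = e / 2 + e / 2 by rewrite -splitr.
apply: (@le_lt_trans _ _ (pr P ((\bigcup_n F n `\` H n) `|` symd (H n) E'))).
  apply: le_pr; first exact: measurable_symd.
    by apply: measurableU; [exact: measurableD|exact: measurable_symd].
  move=> z [[Fz nE]|[Ez nF]]; last by right; right; split=> // /HnF.
  by have [Hz|nHz] := pselect (H n z); [right; left|left].
apply: le_lt_trans (le_prU _ _ _) _; [exact: measurableD|exact: measurable_symd|].
apply: ltrD => //.
have : pr P (\bigcup_n F n) = pr P (H n) + pr P (\bigcup_n F n `\` H n).
  rewrite -prU; [by congr pr; rewrite setDUK|by []|exact: measurableD|].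
  by rewrite setDE setICA setICr setI0.
lra.
Qed.

Lemma measurable_approximable E : measurable E -> approximable E.
Proof.
rewrite measurable_prod_measurableType.
apply: smallest_sub.
  split=> [|A aA|F aF]; first exact: approximable0.
    by rewrite setTD; exact: approximableC.
  exact: approximable_bigcup.
move=> _ [A mA [B mB <-]]; split=> [|e e0]; first exact: measurableX.
have [N [Q ltQ]] := haar_cyl_approx haar_mu mB e0.
have mQ := measurable_proj Q.
exists (A `*` [set x | Q (pf_proj N x)]).
  exists N, (fun c => if Q c then A else set0); split=> [c|]; first by case: ifP.
  apply/seteqP; split=> [[t x] /= [At Qx]|[t x] /=]; first by rewrite Qx.
  by case: ifP.
apply: (@le_lt_trans _ _ (pr P (setT `*` symd B [set x | Q (pf_proj N x)]))).
  apply: le_pr; [|by apply: measurableX => //; exact: measurable_symd|].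
    by apply: measurable_symd; exact: measurableX.
  move=> [t x] [[[/= At Bx] /not_andP[//|nQ]]|[[/= At Qx] /not_andP[//|nB]]].
    by split=> //; left.
  by split=> //; right.
by rewrite pr_rectangle// ?pr_setT ?mul1r//; exact: measurable_symd.
Qed.

End ProductApproximation.

Section LabelApproximation.
Variables (R : realType) (G : groupType).
Variable mu : probability (borelType (profinite G)) R.
Hypothesis haar_mu : is_haar mu.
Let U := uniform_prob (@ltr01 R).
Let Z : measurableType _ := (measurableTypeR R * borelType (profinite G))%type.
Let P : probability Z R := (U \x mu)%E.

(** Each real [t] selects a labelling [lam t] of the finite quotient, so a label of this form is a
    random labelling of [G / N]. *)
Definition cyl_label (N : fin_normal G) (S : Type) (lam : measurableTypeR R ->
  {ffun quot N -> S})
  (z : Z) : S := lam z.1 (pf_proj N z.2).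

Lemma cyl_label_labelling (N : fin_normal G) (S : finType)
    (lam : measurableTypeR R -> {ffun quot N -> S}) :
  labelling lam -> labelling (cyl_label lam).
Proof.
move=> mlam.
have lab1 : labelling (fun z : Z => lam z.1).
  exact: (labelling_act measurable_fst mlam).
have lab2 : labelling (fun z : Z => pf_proj N z.2).
  exact: (labelling_act measurable_snd (@pf_proj_labelling G N)).
exact: (labelling_comp (fun q : {ffun quot N -> S} * quot N => q.1 q.2)
  (labelling_pair lab1 lab2)).
Qed.

(** Approximate each piece separately and pass to a common [N]. Outside the union of the symmetric
    differences exactly one approximating set contains the point, the one of its label. *)
Lemma label_approx (S : finType) (m : Z -> S) (e : R) : labelling m -> 0 < e ->
  exists (N : fin_normal G) (lam : measurableTypeR R -> {ffun quot N -> S}),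
    labelling lam /\ pr P [set z | m z != cyl_label lam z] < e.
Proof.
move=> mm e0.
pose dl := e / (#|S|%:R + 1).
have dl0 : 0 < dl by rewrite divr_gt0// ltr_wpDl.
have ap s := (measurable_approximable haar_mu (mm s)).2 _ dl0.
have {ap} ap (s : S) : exists ND : {N : fin_normal G & quot N ->
  set (measurableTypeR R)},
    (forall c, measurable (projT2 ND c)) /\
    pr P (symd (m @^-1` [set s])
      [set z | projT2 ND (pf_proj (projT1 ND) z.2) z.1]) < dl.
  by have [_ [N [D [mD ->]]] lt] := ap s; exists (existT _ N D).
have {ap} [ND NDP] := choice ap.
pose E s : set Z := [set z | projT2 (ND s) (pf_proj (projT1 (ND s)) z.2) z.1].
have mE s : measurable (E s).
  apply: simple_set_measurable; exists (projT1 (ND s)), (projT2 (ND s)).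
  by split=> //; exact: (NDP s).1.
have [N NN] := fn_bigI [seq projT1 (ND s) | s <- enum S].
have {}NN s : N `<=` projT1 (ND s) by apply: NN; apply: map_f; rewrite mem_enum.
(* The label given where no approximating set contains the point, which happens only inside the
   small exceptional set. *)
pose s0 := m point.
pose lam (t : measurableTypeR R) : {ffun quot N -> S} :=
  [ffun c =>
    odflt s0 [pick s | `[< projT2 (ND s) (quot_map (projT1 (ND s)) c) t >]]].
have mlam : labelling lam.
  apply: labelling_ffun => c.
  have mB : labelling (fun t : measurableTypeR R =>
      [ffun s => `[< projT2 (ND s) (quot_map (projT1 (ND s)) c) t >]] :
        {ffun S -> bool}).
    apply: labelling_ffun => s b.
    have mD := (NDP s).1 (quot_map (projT1 (ND s)) c).
    case: b.
      by congr measurable: mD; apply/seteqP; split=> t /= /asboolP.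
    have := measurableC mD.
    by congr measurable; apply/seteqP; split=> t /=;
      [exact: asboolF|move=> + Dt; rewrite asboolT].
  have := labelling_comp (fun B : {ffun S -> bool} => odflt s0 [pick s | B s]) mB.
  rewrite /comp /=; congr labelling; apply/funext => t; congr odflt.
  by apply: eq_pick => s /=; rewrite ffunE.
exists N, lam; split=> //.
pose symds s := symd (m @^-1` [set s]) (E s).
have msym s : measurable (symds s) by apply: measurable_symd => //; exact: mm.
have lamE z s : E s z =
  `[< projT2 (ND s) (quot_map (projT1 (ND s)) (pf_proj N z.2)) z.1 >] :> Prop.
  by rewrite quot_mapE// asboolE.
apply: (@le_lt_trans _ _ (pr P (\big[setU/set0]_(s : S) symds s))).
  apply: le_pr; last first.
  - move=> z /= /negP neq; apply: contrapT => nz; apply: neq.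
    have Ez s : E s z <-> m z = s.
      apply: iff_sym; apply: (@symdP _ (m @^-1` [set s])) => sz; apply: nz.
      by rewrite -(bigcup_seq (index_enum S)); exists s; rewrite //= mem_index_enum.
    rewrite /cyl_label /lam ffunE; case: pickP => [s|none] /=.
      by rewrite -lamE => /Ez ->.
    have Em : E (m z) z by apply/Ez.
    by rewrite lamE in Em; have := none (m z); rewrite /= Em.
  - by apply: bigsetU_measurable.
  - have :=
    labelling_measurable [pred p | p.1 != p.2]
    (labelling_pair mm (cyl_label_labelling mlam)).
    by [].
have : pr P (\big[setU/set0]_(s : S) symds s) <= \sum_(s : S) pr P (symds s).
  have H (r : seq S) : measurable (\big[setU/set0]_(s <- r) symds s) /\
      pr P (\big[setU/set0]_(s <- r) symds s) <= \sum_(s <- r) pr P (symds s).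
    elim: r => [|s r [mr lr]]; first by rewrite !big_nil pr_set0.
    rewrite !big_cons; split; first exact: measurableU.
    by apply: le_trans (le_prU _ (msym s) mr) _; rewrite lerD2l.
  exact: (H (index_enum S)).2.
move=> /le_lt_trans; apply; apply: (@le_lt_trans _ _ (\sum_(s : S) dl)).
  by apply: ler_sum => s _; exact/ltW/(NDP s).2.
exact: sum_cst_lt.
Qed.

(** The labelling [lam z.1] and the coset of [z.2] are independent and the coset is uniform, so the
    probability is an average of frequencies in labelled copies of [G / N]. *)
Lemma cyl_label_pr (N : fin_normal G) (S : finType)
    (lam : measurableTypeR R -> {ffun quot N -> S}) (g : G) (s s' : S) :
      labelling lam ->
  pr P [set z | cyl_label lam z = s /\
    cyl_label lam (iota_profinite_action g z) = s'] =
  \sum_(f : {ffun quot N -> S}) pr U (lam @^-1` [set f]) *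
    freq R [pred q | (f q == s) && (f (quot_act (profinite_eta g) q) == s')].
Proof.
move=> mlam.
have mlam1 : labelling (fun z : Z => lam z.1).
  exact: (labelling_act measurable_fst mlam).
have mq : labelling (fun z : Z => pf_proj N z.2).
  exact: (labelling_act measurable_snd (@pf_proj_labelling G N)).
pose C (p : {ffun quot N -> S} * quot N) :=
  (p.1 p.2 == s) && (p.1 (quot_act (profinite_eta g) p.2) == s').
have mp := labelling_pair mlam1 mq.
rewrite (_ : [set z | _] = [set z : Z | C (lam z.1, pf_proj N z.2)]); last first.
  apply/seteqP; split=> -[t x]; rewrite /C /cyl_label /= pf_projM.
    by move=> [-> ->]; rewrite !eqxx.
  by move=> /andP[/eqP -> /eqP ->].
rewrite (pr_sum P C mp) [LHS]big_mkcond /=.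
under [RHS]eq_bigr do rewrite freqE mulr_sumr.
rewrite pair_bigA; apply: eq_bigr => -[f q] _ /=; rewrite /C /=.
case: ifP => _; last by rewrite mul0r mulr0.
rewrite (_ : _ @^-1` _ = (lam @^-1` [set f]) `*` (@pf_proj G N @^-1` [set q]));
  last first.
  by apply/seteqP; split=> [[t x] [<- <-]|[t x] [/= -> ->]].
rewrite pr_rectangle//; [congr (_ * _)|exact: (@pf_proj_labelling G N)].
rewrite mul1r (_ : _ @^-1` _ = [set x | pred1 q (pf_proj N x)]); last first.
  by apply/seteqP; split=> x /= /eqP.
by rewrite haar_freq// /freq card1 mul1r.
Qed.

End LabelApproximation.

Lemma MD_fin_approx (R : realType) (G : groupType) d (X : measurableType d)
    (nu : probability X R) (b : G -> X -> X) :
  MD R G -> standard_borel R X -> mp_action nu b -> fin_approx nu b.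
Proof.
move=> [_ _ [mu hmu MDmu]] sX mpb S l ml F e e0.
have mpi := iota_mp_action hmu.
have /(weak_labelsP mpb mpi) wl := MDmu _ X nu b sX mpb.
(* One quarter each for weak containment and for rounding the weights, and two for the change of
   labelling, which may fail at [z] or at its translate. *)
have e40 : 0 < e / 4 by rewrite divr_gt0.
pose l' (x : X) : 'I_#|S| := enum_rank (l x).
have ml' : labelling l' by exact: (labelling_comp (@enum_rank S) ml).
have [m' mm' m'P] := wl _ l' ml' F _ e40.
pose m := (@enum_val S predT) \o m'.
have mm : labelling m by exact: labelling_comp.
have mP g : g \in F -> forall s s', `|pr nu [set x | l x = s /\ l (b g x) = s'] -
    pr (uniform_prob (@ltr01 R) \x mu)%E [set z | m z = s /\
      m (iota_profinite_action g z) = s']| < e / 4.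
  move=> gF s s'; have := m'P g gF (enum_rank s) (enum_rank s').
  rewrite (_ : [set x | l' x = _ /\ _] = [set x | l x = s /\ l (b g x) = s']);
    last first.
    apply/seteqP; split=> x; rewrite /l' /=; last by move=> [-> ->].
    by move=> [/enum_rank_inj -> /enum_rank_inj ->].
  rewrite (_ : [set y | m' y = _ /\ _] = [set z | m z = s /\
    m (iota_profinite_action g z) = s'])//.
  apply/seteqP; split=> x; rewrite /m /=; first by move=> [-> ->];
    rewrite !enum_rankK.
  by move=> [<- <-]; rewrite !enum_valK.
have [N [lam [mlam lamP]]] := label_approx hmu mm e40.
pose Q := quot N; pose c (g : G) (q : Q) : Q := quot_act (profinite_eta g) q.
have cact : is_gaction c := quot_eta_action N.
pose U := uniform_prob (@ltr01 R).
pose w (f : {ffun Q -> S}) := pr U (lam @^-1` [set f]).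
have w1 : \sum_f w f = 1.
  by rewrite -(pr_sum U predT mlam) -[RHS](pr_setT U); congr pr; exact/seteqP.
have [T [a [n [T0 aact am]]]] := weighted_model (fun (f : {ffun Q -> S}) q => f q)
  cact (quot_gt0 N) (fun f => pr_ge0 U _) w1 e40.
exists T, a, n; split=> // g gF s s'.
have := am g s s'; rewrite -(cyl_label_pr hmu g s s' mlam) => H1.
have H2 := mP g gF s s'.
set P := (U \x mu)%E in H1 H2 lamP mpi.
pose D := [set z | m z != cyl_label lam z].
have mc := cyl_label_labelling mlam.
have mD : measurable D :=
  labelling_measurable [pred p | p.1 != p.2] (labelling_pair mm mc).
have mi g' : measurable_fun setT (@iota_profinite_action R G g') by have
  [_ _ + _] := mpi; apply.
have mD' : measurable (iota_profinite_action g @^-1` D) by rewrite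
  -[X in measurable X]setTI; exact: mi.
have pair_meas (k : measurableTypeR R * borelType (profinite G) -> S) :
  labelling k ->
    measurable [set z | k z = s /\ k (iota_profinite_action g z) = s'].
  by move=> mk; exact: (measurableI _ _ (mk s) (labelling_act (mi g) mk s')).
have H3 : `|pr P [set z | m z = s /\ m (iota_profinite_action g z) = s'] -
    pr P [set z | cyl_label lam z = s /\
      cyl_label lam (iota_profinite_action g z) = s']|
    <= pr P (D `|` iota_profinite_action g @^-1` D).
  apply: pr_dist; [exact: pair_meas|exact: pair_meas|exact: measurableU|].
  by move=> z /not_orP[/negP/negPn/eqP h1 /negP/negPn/eqP h2] /=; rewrite h1 h2.
have H4 : pr P (D `|` iota_profinite_action g @^-1` D) <= pr P D + pr P D.
  apply: le_trans (le_prU _ mD mD') _; have [_ _ _ inv] := mpi.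
  by rewrite lerD2l /pr inv.
move: H1 H2 H3 H4 lamP; rewrite -/D.
set x1 := pr nu _; set x2 := pr P _; set x3 := pr P _; set x4 :=
  freq _ _; set x5 := pr P _; set x6 := pr P D.
rewrite !ltr_norml !ler_norml => /andP[? ?] /andP[? ?] /andP[? ?] ? ?.
by apply/andP; split; lra.
Qed.

(** * Coin tossing *)

(* The parameter [R] only serves to make the metric structure inferable. *)
Definition coins (R : realType) : Type := nat -> bool.

Section CoinMetric.
Variable R : realType.
Implicit Types x y z : nat -> bool.

Definition coin_dist x y : R :=
  match pselect (exists i, x i != y i) with
  | left xy => (ex_minn xy).+1%:R^-1
  | right _ => 0
  end.

Lemma coin_distP x y :
  (x = y /\ coin_dist x y = 0) \/
  exists k,
    [/\ x k != y k, (forall i, (i < k)%N -> x i = y i) & coin_dist x y =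
    k.+1%:R^-1].
Proof.
rewrite /coin_dist; case: pselect => [xy|nxy].
  right; case: ex_minnP => k xyk kmin; exists k; split=> // i ik.
  by apply/eqP; apply: contraTT ik => /kmin; rewrite -leqNgt.
left; split=> //; apply/funext => i; apply: contrapT => /eqP xyi.
by apply: nxy; exists i.
Qed.

Lemma coin_dist_ge k x y : x k != y k -> k.+1%:R^-1 <= coin_dist x y.
Proof.
move=> xyk; have [[xy _]|[j [xyj jmin ->]]] := coin_distP x y.
  by rewrite xy eqxx in xyk.
rewrite lef_pV2 ?posrE// ler_nat ltnS leqNgt.
by apply: contra xyk => /jmin ->.
Qed.

Lemma coin_dist_le n x y : (forall i, (i < n)%N -> x i = y i) ->
  coin_dist x y <= n.+1%:R^-1.
Proof.
move=> xyn; have [[_ ->]|[k [xyk _ ->]]] :=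
  coin_distP x y; first by rewrite invr_ge0.
rewrite lef_pV2 ?posrE// ler_nat ltnS leqNgt.
by apply: contra xyk => /xyn ->.
Qed.

Lemma coin_dist_lt k x y : coin_dist x y < k.+1%:R^-1 -> x k = y k.
Proof. by move=> xyk; apply: contrapT => /eqP /coin_dist_ge; rewrite leNgt xyk. Qed.

Lemma coin_distxx x : coin_dist x x = 0.
Proof. by have [[]|[k []]] := coin_distP x x; rewrite ?eqxx. Qed.

Lemma coin_dist_eq0 x y : coin_dist x y = 0 -> x = y.
Proof.
have [[-> //]|[k [_ _ ->]]] := coin_distP x y.
by move/eqP; rewrite invr_eq0 pnatr_eq0.
Qed.

Lemma coin_dist_sym x y : coin_dist x y = coin_dist y x.
Proof.
apply: le_anti; apply/andP; split.
  have [[_ ->]|[k [xyk _ ->]]] := coin_distP x y.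
    by have [[_ ->]|[k [_ _ ->]]] := coin_distP y x; rewrite ?invr_ge0.
  by apply: coin_dist_ge; rewrite eq_sym.
have [[_ ->]|[k [xyk _ ->]]] := coin_distP y x.
  by have [[_ ->]|[k [_ _ ->]]] := coin_distP x y; rewrite ?invr_ge0.
by apply: coin_dist_ge; rewrite eq_sym.
Qed.

Lemma coin_dist_ge0 x y : 0 <= coin_dist x y.
Proof. by have [[_ ->]|[k [_ _ ->]]] := coin_distP x y; rewrite ?invr_ge0. Qed.

Lemma coin_dist_triangle y x z : coin_dist x z <= coin_dist x y + coin_dist y z.
Proof.
have [[_ ->]|[k [xzk _ ->]]] :=
  coin_distP x z; first by rewrite addr_ge0 ?coin_dist_ge0.
have [xyk|xyk] := eqVneq (x k) (y k).
  by apply: le_trans (coin_dist_ge (y := z) (x := y) _) _;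
    [rewrite -xyk|rewrite lerDr coin_dist_ge0].
by apply: le_trans (coin_dist_ge xyk) _; rewrite lerDl coin_dist_ge0.
Qed.

End CoinMetric.

HB.instance Definition _ (R : realType) := Pointed.copy (coins R) (nat -> bool).
HB.instance Definition _ (R : realType) := isMetric.Build R (coins R)
  (@coin_distxx R) (@coin_dist_eq0 R) (@coin_dist_sym R) (@coin_dist_triangle R).

Section CoinSpace.
Variable R : realType.
Implicit Types (x y : coins R) (A : set (coins R)).

Lemma coin_nbhs x A : nbhs x A <->
  exists n, forall y, (forall i, (i < n)%N -> x i = y i) -> A y.
Proof.
rewrite -nbhs_ballE; split=> [[e /= e0 xA]|[n xA]].
  exists (Num.truncn e^-1) => y xy; apply: xA; rewrite ballEmdist /=.
  apply: le_lt_trans (coin_dist_le R xy) _.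
  by rewrite invf_plt ?posrE// truncnS_gt.
exists n.+1%:R^-1 => /=; first by rewrite invr_gt0.
move=> y; rewrite ballEmdist /= => xy; apply: xA => i i_n.
apply: (@coin_dist_lt R); apply: lt_le_trans xy _.
by rewrite lef_pV2 ?posrE// ler_nat ltnW.
Qed.

Lemma coin_openP A : open A <-> forall x, A x ->
  exists n, forall y, (forall i, (i < n)%N -> x i = y i) -> A y.
Proof.
rewrite openE; split=> [oA x /oA /coin_nbhs //|H x /H /coin_nbhs //].
Qed.

(** A Cauchy filter decides every coordinate, and the eventually false sequences form a countable
    dense set. *)
Lemma coin_standard : standard_borel R (borelType (coins R)).
Proof.
exists (coins R); split; last first.
- exists id; split; first by exists id.
  by [].
- exists (range (fun s : seq bool => nth false s : coins R)).
    exact: (sub_countable (card_image_le _ _) (countableP _)).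
  move=> O [x Ox] /coin_openP /(_ _ Ox) [n nO].
  exists (nth false (mkseq x n)); split; last by exists (mkseq x n).
  by apply: nO => i i_n; rewrite nth_mkseq.
move=> F PF /cauchyP cF.
have ex k : exists b, F [set y : coins R | y k = b].
  have [|x Fx] := cF k.+1%:R^-1; first by rewrite invr_gt0.
  exists (x k); apply: filterS Fx => y; rewrite ballEmdist /=.
  by move=> /coin_dist_lt.
have [x xP] := choice ex.
exists (x : coins R) => A /coin_nbhs[n nA].
suff : F [set y : coins R | forall i, (i < n)%N -> x i = y i] by apply:
  filterS => y; exact: nA.
elim: n {nA} => [|n IH]; first by apply: filterS filterT.
apply: filterS (filterI IH (xP n)) => y [/= xy xyn] i.
by rewrite ltnS leq_eqVlt => /predU1P[->|/xy].
Qed.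

Definition coin_prefix (n : nat) x : {ffun 'I_n -> bool} := [ffun i : 'I_n => x i].

(** The words of length [n] whose cylinder lies in [A]. An open set is the increasing union over [n]
    of the cylinders so selected, which reduces measures of open sets to finite words. *)
Definition coin_inner A n : pred {ffun 'I_n -> bool} :=
  fun w => `[< forall y, coin_prefix n y = w -> A y >].

Lemma coin_open_bigcup A : open A ->
  A = \bigcup_n [set x | coin_inner A (coin_prefix n x)].
Proof.
move=> /coin_openP oA; apply/seteqP; split=> [x Ax|x [n _ /asboolP]]; last exact.
have [n nA] := oA _ Ax; exists n => //; apply/asboolP => y /ffunP yx.
by apply: nA => i i_n; have := yx (Ordinal i_n); rewrite !ffunE.
Qed.

Lemma coin_inner_nd A :
  nondecreasing_seq (fun n => [set x | coin_inner A (coin_prefix n x)]).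
Proof.
move=> n m nm; apply/subsetPset => x /= /asboolP xA; apply/asboolP => y /ffunP yx.
apply: xA; apply/ffunP => i; have := yx (widen_ord nm i).
by rewrite !ffunE.
Qed.

Lemma coin_coord_labelling k : labelling (fun z : borelType (coins R) => z k).
Proof.
move=> b; apply: sub_sigma_algebra; apply/coin_openP => x /= xb.
by exists k.+1 => y xy; rewrite -xb xy.
Qed.

Lemma coin_measurable_fun d (Y : measurableType d) (f : Y -> borelType (coins R)) :
  (forall k, labelling (fun t => f t k)) -> measurable_fun setT f.
Proof.
move=> mf;
  apply: (@measurability _ _ _ (borelType (coins R)) _ _ (@open (coins R))) =>
  //.
move=> _ [A oA <-]; rewrite setTI [A](coin_open_bigcup oA) preimage_bigcup.
apply: bigcupT_measurable => n.
apply: (@labelling_measurable _ _ _ (fun t => coin_prefix n (f t))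
  (coin_inner A (n := n))).
by apply: labelling_ffun => i; exact: mf.
Qed.

End CoinSpace.

(** * The coin tossing measure as an image of Haar measure *)

Definition boolseq : Type := nat -> bool.

HB.instance Definition _ := Choice.copy boolseq (nat -> bool).

Section BoolSeqGroup.
Implicit Types f g h : boolseq.

Definition bs_mul f g : boolseq := fun i => f i (+) g i.
Definition bs_one : boolseq := fun=> false.

Lemma bs_mulA : associative bs_mul.
Proof. by move=> f g h; apply/funext => i; rewrite /bs_mul addbA. Qed.

Lemma bs_mul1 : left_id bs_one bs_mul.
Proof. by move=> f; apply/funext => i. Qed.

Lemma bs_mulr1 : right_id bs_one bs_mul.
Proof. by move=> f; apply/funext => i; rewrite /bs_mul addbF. Qed.

Lemma bs_mulV : left_inverse bs_one id bs_mul.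
Proof. by move=> f; apply/funext => i; rewrite /bs_mul addbb. Qed.

HB.instance Definition _ := isGroup.Build boolseq
  bs_mulA bs_mul1 bs_mulr1 bs_mulV bs_mulV.

End BoolSeqGroup.

Section CoinMeasure.
Variable R : realType.

(** For injective [sg] this is a transitive finite set of the group, hence a factor of its profinite
    completion. *)
Definition coord_act (I : finType) (sg : I -> nat) (f : boolseq)
  (c : {ffun I -> bool}) :
  {ffun I -> bool} := [ffun i => f (sg i) (+) c i].

Lemma coord_act_action (I : finType) (sg : I -> nat) : is_gaction (coord_act sg).
Proof.
split=> [c|f g c]; apply/ffunP => i; rewrite !ffunE //.
by rewrite [(f * g)%g]/(bs_mul f g) /bs_mul addbA.
Qed.

Lemma coord_act_transitive (I : finType) (sg : I -> nat) : injective sg ->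
  gtransitive (coord_act sg).
Proof.
move=> sgi c c'.
exists (fun n => if [pick i | sg i == n] is Some i then c i (+) c' i else false).
apply/ffunP => i; rewrite ffunE; case: pickP => [j /eqP /sgi ->|/(_ i)];
  last by rewrite eqxx.
by rewrite addbAC addbb.
Qed.

Definition coords (I : finType) (sg : I ->
  nat) (x : borelType (profinite boolseq)) :
  {ffun I -> bool} := trans_map (coord_act_action sg) [ffun=> false] x.

Definition coord (k : nat) (x : borelType (profinite boolseq)) : bool :=
  coords (fun _ : unit => k) x tt.

(** A representative [g] of [x] modulo both kernels computes either side. *)
Lemma coordsE (I : finType) (sg : I -> nat) x : coords sg x =
  [ffun i => coord (sg i) x].
Proof.
apply/ffunP => i; rewrite ffunE.
pose N := act_kernel (coord_act_action sg).
pose M := act_kernel (coord_act_action (fun _ : unit => sg i)).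
have [g gE] := pf_coset x (fnI N M).
rewrite /coord /coords /trans_map.
rewrite (trans_factorE _ (pf_val_sub (M := N) _ gE)); last by move=> z [].
rewrite (trans_factorE _ (pf_val_sub (M := M) _ gE)); last by move=> z [].
by rewrite !ffunE.
Qed.

Lemma coord_labelling k : labelling (coord k).
Proof.
exact: (labelling_comp (fun c : {ffun unit -> bool} => c tt)
  (trans_map_labelling (coord_act_action (fun _ : unit => k)) [ffun=> false])).
Qed.

Definition coin_map (x : borelType (profinite boolseq)) : borelType (coins R) :=
  fun k => coord k x.

Lemma coin_map_measurable : measurable_fun setT coin_map.
Proof. by apply: coin_measurable_fun => k; exact: coord_labelling. Qed.

HB.instance Definition _ :=
  isMeasurableFun.Build _ _ _ _ coin_map coin_map_measurable.

(* Coin tossing is the image of Haar measure on the profinite completion of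
   [(Z/2)^nat]: finitely many coordinates are jointly uniform since the group acts
   transitively on their values. *)
Definition coin_prob : probability (borelType (coins R)) R :=
  distribution (@haar R boolseq : probability (borelType (profinite boolseq)) R)
    coin_map.

Lemma coin_prob_freq (I : finType) (sg : I -> nat) (P : pred {ffun I -> bool}) :
  injective sg -> pr coin_prob [set x | P [ffun i => x (sg i)]] = freq R P.
Proof.
move=> sgi.
have := trans_map_freq (coord_act_action sg) (coord_act_transitive sgi)
  [ffun=> false] P (@haar_is_haar R boolseq).
move=> <-; congr (fine (@haar R boolseq _)); apply/seteqP; split=> x /=.
  by rewrite -/(coords sg x) coordsE.
by rewrite -/(coords sg x) coordsE.
Qed.

Definition reindex (sg : nat -> nat) (x : borelType (coins R)) :
  borelType (coins R) :=
  fun k => x (sg k).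

Lemma reindex_measurable sg : measurable_fun setT (reindex sg).
Proof. by apply: coin_measurable_fun => k; exact: coin_coord_labelling. Qed.

HB.instance Definition _ sg :=
  isMeasurableFun.Build _ _ _ _ (reindex sg) (reindex_measurable sg).

(** Both measures are uniform on finitely many coordinates, hence agree on open sets by passing to
    the limit, and the open sets are closed under intersection and generate the Borel sets. *)
Lemma reindex_inv sg (A : set (borelType (coins R))) : injective sg ->
  measurable A ->
  coin_prob (reindex sg @^-1` A) = coin_prob A.
Proof.
move=> sgi mA.
rewrite -[LHS]/(distribution coin_prob (reindex sg) A).
apply: (@measure_unique _ R (borelType (coins R)) (@open (coins R)) (fun=> setT)
  erefl
  _ _ _ (distribution coin_prob (reindex sg)) coin_prob _ _ A mA).
- exact: openI.
- by move=> _; exact: openT.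
- by apply/seteqP; split=> // x _; exists 0%N.
- move=> B oB.
  pose C n : set (borelType (coins R)) :=
    [set x | @coin_inner R B n (@coin_prefix R n x)].
  have mC n : measurable (C n).
    apply: (@labelling_measurable _ (borelType (coins R)) _ (@coin_prefix R n)
      (@coin_inner R B n)).
    by apply: labelling_ffun => i; exact: coin_coord_labelling.
  have mCU : measurable (\bigcup_n C n) by exact: bigcupT_measurable.
  have lim (m : probability (borelType (coins R)) R) : m \o C @ \oo --> m B.
    rewrite [B](coin_open_bigcup oB).
    exact: (nondecreasing_cvg_mu mC mCU (@coin_inner_nd _ B)).
  have E : distribution coin_prob (reindex sg) \o C = coin_prob \o C.
    apply/funext => n;
      apply: etrans (pr_fin (distribution coin_prob (reindex sg)) (mC n)) _.
    apply: etrans (esym (pr_fin coin_prob (mC n))); congr EFin.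
    apply: etrans (esym (@coin_prob_freq 'I_n val (@coin_inner R B n) val_inj)).
    exact: (@coin_prob_freq 'I_n (sg \o val) (@coin_inner R B n)
      (inj_comp sgi val_inj)).
  have l1 := lim (distribution coin_prob (reindex sg)); rewrite E in l1.
  exact: (cvg_unique _ l1 (lim coin_prob)).
- move=> _; apply: (@le_lt_trans _ _ 1%E); last exact: ltry.
  exact: (probability_le1 (distribution coin_prob (reindex sg)) measurableT).
Qed.

End CoinMeasure.

(* The Bernoulli shift moves mass between the cylinders of two coordinates, which
   no action factoring through a trivial profinite completion can approximate. *)
Lemma MD_nontrivial (R : realType) (G : groupType) : MD R G ->
  exists (N : fin_normal G) (g : G), ~ fn_set N g.
Proof.
move=> [cG iG [mu hmu MDmu]]; apply: contrapT => trivial.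
have full (N : fin_normal G) g : fn_set N g.
  by apply: contrapT => nN; apply: trivial; exists N, g.
have act_id g x : @profinite_action G g x = x.
  apply: pf_inj => N; have [h hE] := pf_coset x N.
  rewrite hE (@pf_mulE _ _ _ N g h)//; apply/coset_left_eq; exact: full.
have [g0 g01] : exists g : G, g <> 1%g.
  apply: contrapT => all1; apply: iG; apply: (@sub_finite_set _ _ [set 1%g]) =>
    // g _.
  by apply: contrapT => g1; apply: all1; exists g.
have /countable_injP[e einj] := cG.
have {}einj : injective e by move=> g h; apply: einj; rewrite inE.
(* Left translation by [g^-1] transported to [nat] by [e]; the identity off the
   image of [e]. *)
pose sg (g : G) (k : nat) : nat :=
  match pselect (exists h, e h = k) with
  | left H => e (g^-1 * sval (cid H))%g
  | right _ => k
  end.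
have sgE g h : sg g (e h) = e (g^-1 * h)%g.
  rewrite /sg; case: pselect => [H|[]]; last by exists h.
  by case: cid => h' /= /einj ->.
have sgN g k : ~ (exists h, e h = k) -> sg g k = k by rewrite /sg; case: pselect.
have sgM g h k : sg (g * h)%g k = sg h (sg g k).
  have [[t <-]|nk] := pselect (exists h, e h = k); last by rewrite !sgN.
  by rewrite !sgE invgM mulgA.
have sg1 k : sg 1%g k = k.
  have [[t <-]|nk] := pselect (exists h, e h = k); last by rewrite sgN.
  by rewrite sgE invg1 mul1g.
have sg_inj g : injective (sg g).
  by move=> k k' /(congr1 (sg g^-1%g)); rewrite -!sgM mulgV !sg1.
pose b (g : G) : borelType (coins R) -> borelType (coins R) := reindex (sg g).
have mpb : mp_action (coin_prob R) b.
  split=> [x|g h x|g|g A mA].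
  - by apply/funext => k; rewrite /b /reindex sg1.
  - by apply/funext => k; rewrite /b /reindex sgM.
  - exact: reindex_measurable.
  - exact: reindex_inv.
have /(weak_labelsP mpb (iota_mp_action hmu)) wl :=
  MDmu _ _ _ b (coin_standard R) mpb.
pose o (c : bool) : 'I_2 := if c then ord_max else ord0.
pose l (x : borelType (coins R)) : 'I_2 := o (x (e 1%g)).
have ml : labelling l by apply: labelling_comp; exact: coin_coord_labelling.
(* The event that the coordinate [e 1] is true and the coordinate [e g0^-1] is false has probability
   exactly 1/4, whereas its counterpart is empty where [g0] acts trivially. *)
have e40 : 0 < 4^-1 :> R by [].
have [m mm /(_ g0 (mem_head _ _) ord_max ord0)] := wl _ l ml [:: g0] _ e40.
rewrite [X in _ - pr _ X](_ : _ = set0); last first.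
  rewrite -subset0 => -[t x] /=; rewrite /iota_profinite_action /= act_id.
  by move=> [->] /(congr1 val).
pose two (c : bool) : nat := if c then e 1%g else e g0^-1%g.
have two_inj : injective two.
  have gN : g0^-1%g <> 1%g by move=> g1; apply: g01; rewrite -(invgK g0) g1 invg1.
  by move=> [] [] //= /einj; [move=> /esym /gN|move=> /gN].
rewrite [X in pr _ X](_ : _ =
  [set x | (pred1 [ffun c : bool => c]) [ffun c => x (two c)]]); last first.
  apply/seteqP; split=> x; rewrite /l /o /b /reindex /= sgE mulg1.
    case x1: (x (e 1%g)) => -[H1 H2]; last by move: H1 => /(congr1 val).
    case x2: (x (e g0^-1%g)) H2 => H2; first by move: H2 => /(congr1 val).
    by apply/eqP/ffunP => -[]; rewrite !ffunE /= ?x1 ?x2.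
  move=> /eqP/ffunP eqx; have := eqx true; have := eqx false.
  by rewrite !ffunE /= => -> ->.
rewrite coin_prob_freq// pr_set0 subr0 /freq card1 card_ffun card_bool.
by rewrite ger0_norm// mul1r ltxx.
Qed.

(** * The free product *)

Lemma proper_fin_normal_action (G : groupType) (N : fin_normal G) (g : G) :
  ~ fn_set N g ->
  exists (Q : finType) (c : G -> Q -> Q),
    [/\ is_gaction c, gtransitive c & (1 < #|Q|)%N].
Proof.
move=> Ng; exists (quot N), (fun g => quot_act (profinite_eta g)); split.
- exact: quot_eta_action.
- move=> q q'; have [h <-] := pf_proj_eta_surj q; have [h' <-] :=
  pf_proj_eta_surj q'.
  by exists (h' * h^-1)%g; rewrite -pf_projM -profinite_etaM mulgKV.
- apply/fintype.card_gt1P; exists (pf_proj N (profinite_eta 1%g)),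
  (pf_proj N (profinite_eta g)).
  split=> //; apply/eqP => /esym /pf_projP /esym /coset_left_eq.
  by rewrite invg1 mul1g.
Qed.

Lemma nontrivial_finite_action (R : realType) (G : groupType) :
  (exists g : G, g <> 1%g) -> finite_set [set: G] \/ MD R G ->
  exists (Q : finType) (c : G -> Q -> Q),
    [/\ is_gaction c, gtransitive c & (1 < #|Q|)%N].
Proof.
move=> [g g1] [/fin_normal1 [N N1]|/MD_nontrivial [N [h Nh]]].
  by apply: (@proper_fin_normal_action _ N g) => /N1.
exact: (proper_fin_normal_action Nh).
Qed.

Lemma free_product_countable (G1 G2 : groupType) :
  countable [set: G1] -> countable [set: G2] -> countable [set: free_product G1 G2].
Proof.
move=> /countable_injP[e1 e1inj] /countable_injP[e2 e2inj].
pose code (l : G1 + G2) : nat + nat :=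
  match l with inl x => inl (e1 x) | inr y => inr (e2 y) end.
have code_inj : injective code.
  move=> [x|x] [y|y] //= [].
    by move=> /e1inj ->//; rewrite inE.
  by move=> /e2inj ->//; rewrite inE.
apply/countable_injP; exists (fun a => pickle (map code (repr a))) => a b _ _.
move=> /(pcan_inj pickleK) /(inj_map code_inj) ab.
by rewrite -(fp_reprK a) ab fp_reprK.
Qed.

(* A finite group acts transitively on small sets only, whereas [transitivize]
   yields transitive actions on arbitrarily large ones. *)
Lemma free_product_infinite (R : realType) (G1 G2 : groupType) (Q1 Q2 : finType)
    (c1 : G1 -> Q1 -> Q1) (c2 : G2 -> Q2 -> Q2) :
  is_gaction c1 -> is_gaction c2 -> gtransitive c1 -> gtransitive c2 ->
  (1 < #|Q1|)%N -> (1 < #|Q2|)%N -> infinite_set [set: free_product G1 G2].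
Proof.
move=> c1act c2act c1tr c2tr Q12 Q22 /finite_seqP[s sE].
have tact (G : groupType) : is_gaction (fun (_ : G) (t : unit) => t) by [].
have T0 : (0 < #|{: unit}|)%N by rewrite card_unit.
(* Starting from a one-point model, ask for more points than the list [s] of all group elements has
   entries. *)
have [W [a [_ [sW _ atr _]]]] :=
  @transitivize R _ _ _ _ _ unit _ _ id _ _ [::] 1 (size s)
  (tact G1) (tact G2) c1act c2act c1tr c2tr Q12 Q22 T0 ltr01.
have /fintype.card_gt0P[w0 _] : (0 < #|W|)%N by apply: leq_ltn_trans sW.
suff : (#|W| <= size s)%N by rewrite leqNgt sW.
rewrite -(size_map (fun g => a g w0) s) cardE; apply: uniq_leq_size;
  first exact: enum_uniq.
move=> w _; have [g <-] := atr w0 w; apply: map_f.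
by have : [set` s] g by rewrite -sE.
Qed.

Theorem theorem4p8 (R : realType) (G1 G2 : groupType)
    (countable1 : countable [set: G1]) (countable2 : countable [set: G2])
    (nontrivial1 : exists g : G1, g <> 1%g)
    (nontrivial2 : exists g : G2, g <> 1%g)
    (finite_or_MD1 : finite_set [set: G1] \/ MD R G1)
    (finite_or_MD2 : finite_set [set: G2] \/ MD R G2) :
  EMD R (free_product G1 G2).
Proof.
have [Q1 [c1 [c1act c1tr Q12]]] :=
  nontrivial_finite_action nontrivial1 finite_or_MD1.
have [Q2 [c2 [c2act c2tr Q22]]] :=
  nontrivial_finite_action nontrivial2 finite_or_MD2.
split; first exact: free_product_countable.
  exact: (free_product_infinite R c1act c2act).
exists (@haar R (free_product G1 G2)); first exact: haar_is_haar.
move=> d X nu b sX mpb.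
apply/(weak_labelsP mpb (profinite_mp_action (@haar_is_haar R _))).
apply: (weak_labels_profinite (@haar_is_haar R _) c1act c2act) => //.
have bact := mp_action_gaction mpb.
(* The restriction to a factor is a measure preserving action on the same standard Borel space, so
   both alternatives of the hypothesis make it finitely approximable. *)
have approx (G : groupType) (h : G -> free_product G1 G2) :
    {morph h : x y / (x * y)%g} -> finite_set [set: G] \/ MD R G ->
      fin_approx nu (b \o h).
  move=> hM fM; have mph : mp_action nu (b \o h).
    have [b1 bM] := gaction_comp hM bact; have [_ _ bm binv] := mpb.
    by split=> // [g|g A mA]; [exact: bm|exact: binv].
  by case: fM => [fG|mdG]; [exact: finite_fin_approx|exact: MD_fin_approx].
apply: amalgam => //; first by have [_ _ + _] := mpb.
- by apply: approx => //; exact: fp_inlM.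
- by apply: approx => //; exact: fp_inrM.
Qed.
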